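(* For all nonnegative integers $n$, $m$ and $k$, the following three sets are in bijection (in particular they have the same cardinality): (1) $\mathcal{H}^{(k)}_{n,m}$, the set of hesitating tableaux of length $2n$, with height bounded by $k$, starting from $\emptyset$ and ending in the one-row shape $(m)$; (2) $\mathcal{L}^{(k)}_{n,m}$, the set of $W_k$-hesitating lattice walks of length $2n$ starting at $\delta=(k,k-1,\dots,1)$ and ending at $(m+k,k-1,\dots,1)$; (3) $\Omega^{(k)}_{n,m}$, the set of open partition diagrams on $n$ vertices with exactly $m$ open arcs that contain neither an enhanced $(k+1)$-nesting nor a future enhanced $(k+1)$-nesting.
   Context: Ferrers diagrams are identified with integer partitions; $(0)$ denotes the empty shape $\emptyset$. A hesitating tableau of length $2n$ is a sequence of Ferrers diagrams $\emptyset=\lambda^0,\lambda^1,\dots,\lambda^{2n}$ such that for each $0\le i<n$ the pair of moves $\lambda^{2i}\to\lambda^{2i+1}\to\lambda^{2i+2}$ is of one of the forms: (i) do nothing, then add a box; (ii) remove a box, then do nothing; (iii) add a box, then remove a box. It has height bounded by $k$ if no diagram in the sequence has more than $k$ rows. Let $W_k=\{(x_1,\dots,x_k)\in\mathbb{Z}^k : x_1>x_2>\dots>x_k>0\}$ and let $e_i$ denote the $i$-th standard unit vector; a ''stay step'' is the zero step. A $W_k$-hesitating walk of length $2n$ is a sequence of $2n$ steps, grouped in $n$ consecutive pairs, each pair being one of: (i) a stay step followed by a step $e_i$; (ii) a step $-e_i$ followed by a stay step; (iii) a step $e_i$ followed by a step $-e_j$ (for some $1\le i,j\le k$), such that all visited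 points lie in $W_k$. An open partition diagram on $n$ vertices consists of vertices $1,\dots,n$ on a line together with a set of closed arcs $(i,j)$ with $1\le i<j\le n$ and a set of open arcs, each open arc having a left endpoint in $\{1,\dots,n\}$ and no right endpoint, such that each vertex is the left endpoint of at most one arc (closed or open) and the right endpoint of at most one closed arc. A vertex incident to no arc is regarded as a degenerate arc $(i,i)$ for the purpose of enhanced nestings. Arcs $(i_1,j_1),\dots,(i_r,j_r)$ (closed or degenerate) form an enhanced $r$-nesting if $i_1<i_2<\dots<i_r\le j_r<\dots<j_2<j_1$. A future enhanced $(k+1)$-nesting is an open arc with left endpoint $a$ together with an enhanced $k$-nesting $(i_1,j_1),\dots,(i_k,j_k)$ with $a<i_1$ (i.e. an open arc to the left of an enhanced $k$-nesting). *)

(* Defs.v *)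
From HB Require Import structures.
From mathcomp Require Import all_boot all_order all_algebra.

Set Implicit Arguments.
Unset Strict Implicit.
Unset Printing Implicit Defensive.

Import Order.TTheory GRing.Theory Num.Theory.

(* Ferrers diagrams are weakly decreasing sequences of positive row lengths,
   so the number of rows is the size of the sequence. *)
Definition ferrers (la : seq nat) : bool := sorted geq la && (0 \notin la).

Definition one_row (m : nat) : seq nat := if m == 0 then [::] else [:: m].

(* Whether the result is again a Ferrers diagram is not checked here: every
   diagram of a tableau is required to satisfy [ferrers]. *)
Definition add_box (la mu : seq nat) : bool :=
  [exists i : 'I_(size la).+1, mu == incr_nth la i].

Definition remove_box (la mu : seq nat) : bool := add_box mu la.

Definition hesitating_moves (la mu nu : seq nat) : bool :=
  [|| (mu == la) && add_box mu nu,
      remove_box la mu && (nu == mu)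
    | add_box la mu && remove_box mu nu].

Definition is_hesitating_tableau (k n m : nat)
    (t : (2 * n).+1.-tuple (seq nat)) : bool :=
  let lam := nth [::] t in
  [&& all ferrers t,
      all (fun la => size la <= k) t,
      lam 0 == [::],
      lam (2 * n) == one_row m
    & [forall i : 'I_n,
         hesitating_moves (lam (2 * i)) (lam (2 * i).+1) (lam (2 * i).+2)]].

Definition hesitating_tableau (k n m : nat) : Type :=
  {t : (2 * n).+1.-tuple (seq nat) | is_hesitating_tableau k m t}.

Section Walks.

Local Open Scope ring_scope.

Variable k : nat.

Definition in_chamber (x : 'rV[int]_k) : bool :=
  [forall i : 'I_k, forall j : 'I_k, (i < j)%N ==> (x 0 j < x 0 i)] &&
  [forall i, 0 < x 0 i].

Definition unit_vec (i : 'I_k) : 'rV[int]_k := delta_mx 0 i.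

Definition hesitating_steps (s s' : 'rV[int]_k) : bool :=
  [|| (s == 0) && [exists i, s' == unit_vec i],
      [exists i, s == - unit_vec i] && (s' == 0)
    | [exists i, s == unit_vec i] && [exists j, s' == - unit_vec j]].

Definition delta : 'rV[int]_k := \row_(i < k) (k - i)%N%:Z.

(* [x] is the point (m + k, k - 1, ..., 1), i.e. delta with m added to its
   first coordinate.  If k = 0 there is no first coordinate, so no such point
   exists when m > 0, and it is the empty vector when m = 0. *)
Definition is_endpoint (m : nat) (x : 'rV[int]_k) : bool :=
  ((0 < k)%N || (m == 0%N)) &&
  (x == \row_(i < k) (if val i == 0%N then (m + k)%N%:Z else (k - i)%N%:Z)).

Definition position (n : nat) (w : (2 * n).-tuple 'rV[int]_k) (t : nat) :
    'rV[int]_k :=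
  delta + \sum_(s <- take t w) s.

Definition is_hesitating_walk (n m : nat)
    (w : (2 * n).-tuple 'rV[int]_k) : bool :=
  [&& [forall i : 'I_n, hesitating_steps (nth 0 w (2 * i)) (nth 0 w (2 * i).+1)],
      [forall t : 'I_(2 * n).+1, in_chamber (position w t)]
    & is_endpoint m (position w (2 * n))].

Definition hesitating_walk (n m : nat) : Type :=
  {w : (2 * n).-tuple 'rV[int]_k | is_hesitating_walk m w}.

End Walks.

(* Vertices 1, ..., n are represented by 0, ..., n - 1.  The first component is
   the set of closed arcs, the second the set of left endpoints of open arcs
   (a vertex carries at most one open arc). *)
Definition diagram (n : nat) : finType :=
  ({set 'I_n * 'I_n} * {set 'I_n})%type.

Section Diagrams.

Variables (n : nat) (D : diagram n).

Definition closed_arcs : {set 'I_n * 'I_n} := D.1.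

Definition open_arcs : {set 'I_n} := D.2.

Definition is_open_partition_diagram : bool :=
  [&& [forall a in closed_arcs, (a.1 < a.2)%N],
      [forall a in closed_arcs, forall b in closed_arcs,
         (a.1 == b.1) ==> (a == b)],
      [forall a in closed_arcs, a.1 \notin open_arcs]
    & [forall a in closed_arcs, forall b in closed_arcs,
         (a.2 == b.2) ==> (a == b)]].

Definition isolated (v : 'I_n) : bool :=
  (v \notin open_arcs) &&
  [forall a in closed_arcs, (a.1 != v) && (a.2 != v)].

Definition enhanced_arcs : {set 'I_n * 'I_n} :=
  closed_arcs :|: [set (v, v) | v in isolated].

Definition left_ends (s : seq ('I_n * 'I_n)) : seq nat :=
  [seq val a.1 | a <- s].

Definition right_ends (s : seq ('I_n * 'I_n)) : seq nat :=
  [seq val a.2 | a <- s].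

(* i_1 < ... < i_r <= j_r < ... < j_1; the empty family is a 0-nesting. *)
Definition enhanced_nesting (r : nat) (s : r.-tuple ('I_n * 'I_n)) : bool :=
  [&& all (mem enhanced_arcs) s,
      sorted ltn (left_ends s),
      last 0 (left_ends s) <= last 0 (right_ends s)
    & sorted gtn (right_ends s)].

Definition has_enhanced_nesting (r : nat) : bool :=
  [exists s : r.-tuple ('I_n * 'I_n), enhanced_nesting s].

(* [has_future_enhanced_nesting k] is about future enhanced (k+1)-nestings:
   [path] adds a < i_1 to i_1 < ... < i_k, which is no constraint on the open
   arc a if k = 0. *)
Definition has_future_enhanced_nesting (k : nat) : bool :=
  [exists a in open_arcs, exists s : k.-tuple ('I_n * 'I_n),
     enhanced_nesting s && path ltn (val a) (left_ends s)].

Definition in_Omega (k m : nat) : bool :=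
  [&& is_open_partition_diagram,
      #|open_arcs| == m,
      ~~ has_enhanced_nesting k.+1
    & ~~ has_future_enhanced_nesting k].

End Diagrams.

Definition open_diagram (k n m : nat) : Type :=
  {D : diagram n | in_Omega D k m}.

(* Main.v *)
(* Write the growth of a Ferrers diagram as a lattice word: the letter at time
   v is the column of the box added at time v, or None.  Scan the vertices of a
   diagram from right to left, starting from the word 0 1 ... m-1 placed at the
   open vertices.  When an arc (i, v) closes at v, insert at position i: a 0
   appears there, the next 0 to its right becomes 1, the next 1 after that
   becomes 2, and so on; then delete the last letter, which tells how v opens
   an arc.  Each step is reversible, since the increment of the counts says
   which letter has to be followed back, so diagrams correspond to sequences
   of shapes, namely to hesitating tableaux.  The number of 0s in a prefix,
   which is the height of its shape, obeys the recursion
   z(s) := max(z(s), z(i) + 1) for s > i, the one of the longest (future)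
   enhanced nesting of processed arcs with left ends in this prefix.
   Adding delta to a shape turns tableaux into walks. *)

Require Import Defs.
From mathcomp Require Import all_boot all_order all_algebra.
From mathcomp Require Import zify.
From Stdlib Require Import IndefiniteDescription.

Set Implicit Arguments.
Unset Strict Implicit.
Unset Printing Implicit Defensive.

(** * Ferrers diagrams as functions on row indices *)

Lemma ferrers_nth (la : seq nat) (i j : nat) :
  ferrers la -> i <= j -> nth 0 la j <= nth 0 la i.
Proof.
case/andP=> sla _ lij; have [jla|?] := ltnP j (size la); last by rewrite nth_default.
by apply: (sorted_leq_nth (rev_trans leq_trans) leqnn 0 sla); rewrite ?inE //; lia.
Qed.

Lemma ferrers_nth_gt0 (la : seq nat) (i : nat) :
  ferrers la -> (0 < nth 0 la i) = (i < size la).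
Proof.
case/andP=> _ n0; have [ila|?] := ltnP i (size la); last by rewrite nth_default.
by rewrite lt0n; apply: contraNneq n0 => <-; rewrite mem_nth.
Qed.

(** Rows are positive, so the length can be read off the values and the default 0 past the end loses
    no information. *)
Lemma ferrers_nth_inj (la mu : seq nat) :
  ferrers la -> ferrers mu -> nth 0 la =1 nth 0 mu -> la = mu.
Proof.
move=> fla fmu e; apply: (@eq_from_nth _ 0) => // .
have h i : (i < size la) = (i < size mu).
  by rewrite -!ferrers_nth_gt0 // e.
by have := h (size la); have := h (size mu); lia.
Qed.

Lemma add_boxP (la mu : seq nat) :
  reflect (exists2 r, r <= size la & mu = incr_nth la r) (add_box la mu).
Proof.
apply: (iffP existsP) => [[i /eqP ->]|[r lr ->]]; first by exists i; rewrite // -ltnS.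
by exists (Ordinal (lr : r < (size la).+1)).
Qed.

(** * Lattice words with blanks and their shapes *)

(* Words are stored with the latest letter first, so position i of w is
   [nth None (rev w) i]. *)
Definition word : Type := seq (option nat).

Definition cnt (w : word) (j : nat) : nat := count_mem (Some j) w.

(** The ballot (Yamanouchi) condition. The tail of a list is an earlier prefix, so testing each
    letter against its tail tests all prefixes; blanks and 0s are always allowed. *)
Fixpoint lattice (w : word) : bool :=
  if w is a :: w' then
    lattice w' && (if a is Some j.+1 then cnt w' j.+1 < cnt w' j else true)
  else true.

Lemma lattice_cnt (w : word) (j : nat) : lattice w -> cnt w j.+1 <= cnt w j.
Proof.
elim: w => //= -[[|d]|] w IH /andP[/IH lw]; rewrite /cnt /= -!/(cnt _ _) //.
  by move=> _; rewrite !(inj_eq Some_inj); lia.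
by rewrite !(inj_eq Some_inj) => hd; case: eqVneq => [[?]|?]; subst; lia.
Qed.

Lemma lattice_cnt_le (w : word) (i j : nat) :
  lattice w -> i <= j -> cnt w j <= cnt w i.
Proof.
move=> lw; elim: j => [|j IH]; first by rewrite leqn0 => /eqP ->.
rewrite leq_eqVlt => /orP[/eqP -> //|]; rewrite ltnS => /IH.
exact/leq_trans/lattice_cnt.
Qed.

(** Column j has height [cnt w' j], so this is the index of the row that receives the new box. The
    counts are the conjugate partition of the shape. *)
Fixpoint row_shape (w : word) : seq nat :=
  match w with
  | [::] => [::]
  | None :: w' => row_shape w'
  | Some j :: w' => incr_nth (row_shape w') (cnt w' j)
  end.

Lemma nth_row_shape (w : word) (i j : nat) :
  lattice w -> (j < nth 0 (row_shape w) i) = (i < cnt w j).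
Proof.
elim: w i j => [|[d|] w IH] i j; rewrite ?nth_nil // => /= /andP[lw hd]; last exact: IH.
rewrite nth_incr_nth /cnt /= -!/(cnt _ _) (inj_eq Some_inj).
(* [h1] and [h2] together say that row [cnt w d] has length exactly d, so the new box has
   coordinates (cnt w d, d). *)
have h1 := IH (cnt w d) d lw; rewrite ltnn in h1.
have h2 : d <= nth 0 (row_shape w) (cnt w d).
  by case: d hd {h1} => // d hd; rewrite IH.
have h3 := IH i j lw.
case: (eqVneq (cnt w d) i) => [e|ne]; last first.
  by rewrite h3; case: (eqVneq d j) => [e|//]; subst; lia.
case: (eqVneq d j) => [e'|ne']; subst; first by lia.
lia.
Qed.

Lemma size_row_shape (w : word) : lattice w -> size (row_shape w) = cnt w 0.
Proof.
elim: w => //= -[d|] w IH /andP[lw hd]; last exact: IH.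
rewrite size_incr_nth IH // /cnt /= -!/(cnt _ _) (inj_eq Some_inj).
by case: d hd => [|d] hd; rewrite ?ltnn // (leq_trans hd) // lattice_cnt_le.
Qed.

Lemma ferrers_row_shape (w : word) : lattice w -> ferrers (row_shape w).
Proof.
move=> lw; apply/andP; split.
  apply/(sortedP 0) => i _; rewrite /geq /=.
  have := nth_row_shape i (nth 0 (row_shape w) i) lw.
  have := nth_row_shape i.+1 (nth 0 (row_shape w) i) lw.
  by rewrite ltnn; lia.
apply/negP => /(nthP 0)[i]; rewrite size_row_shape // => h.
by rewrite -(nth_row_shape _ _ lw) in h => e; rewrite e in h.
Qed.

Lemma row_shape_cnt (w w' : word) : lattice w -> lattice w' ->
  row_shape w = row_shape w' <-> cnt w =1 cnt w'.
Proof.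
move=> lw lw'; split=> [e j|e].
  have h i : (i < cnt w j) = (i < cnt w' j) by rewrite -!nth_row_shape // e.
  by have := h (cnt w j); have := h (cnt w' j); lia.
apply: ferrers_nth_inj; rewrite ?ferrers_row_shape // => i.
have h j : (j < nth 0 (row_shape w) i) = (j < nth 0 (row_shape w') i).
  by rewrite !nth_row_shape // e.
by have := h (nth 0 (row_shape w) i); have := h (nth 0 (row_shape w') i); lia.
Qed.

Lemma sumn_row_shape (w : word) : sumn (row_shape w) = count isSome w.
Proof.
elim: w => //= -[d|] w IH //=; rewrite -IH add1n.
by elim: (row_shape w) (cnt w d) => [|x s IHs] [|i] //=;
  rewrite ?IHs ?addnS // ?sumn_ncons ?mul0n //.
Qed.

(** The shape depends only on the counts, so w' may be replaced by [Some j :: w]. This covers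
    insertion, where the extra letter need not be the latest one. *)
Lemma row_shape_add_box (w w' : word) (j : nat) :
  lattice w -> lattice w' -> (forall d, cnt w' d = cnt w d + (d == j)) ->
  add_box (row_shape w) (row_shape w').
Proof.
move=> lw lw' e.
have lj : lattice (Some j :: w).
  rewrite /= lw; case: j e => //= j e; have := lattice_cnt j lw'.
  by rewrite !e eqxx; case: eqP => [|_]; lia.
have -> : row_shape w' = row_shape (Some j :: w).
  apply/row_shape_cnt => // d; rewrite e /cnt /= (inj_eq Some_inj) eq_sym; lia.
apply/add_boxP; exists (cnt w j) => //.
by rewrite size_row_shape // lattice_cnt_le.
Qed.

Lemma add_box_letter (w : word) (mu : seq nat) :
  lattice w -> ferrers mu -> add_box (row_shape w) mu ->
  exists2 j, lattice (Some j :: w) & row_shape (Some j :: w) = mu.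
Proof.
move=> lw fmu /add_boxP[r lr emu].
have e i : nth 0 mu i = (r == i) + nth 0 (row_shape w) i by rewrite emu nth_incr_nth.
(* The new box ends row r, hence lies in column j. Rows above r are longer than j because [mu]
   decreases, so column j has height r. *)
pose j := nth 0 (row_shape w) r.
have cj : cnt w j = r.
  have h i : (i < cnt w j) = (i < r).
    rewrite -nth_row_shape //; case: (ltnP i r) => [ir|ri].
      have := ferrers_nth fmu (ltnW ir); rewrite !e eqxx /j.
      by case: eqP ir => [->|_]; rewrite ?ltnn //; lia.
    by have := ferrers_nth (ferrers_row_shape lw) ri; rewrite /j; lia.
  by have := h r; have := h (cnt w j); lia.
exists j; last by rewrite /= cj.
by rewrite /= lw; case E: j => [|j'] //=; rewrite -E cj -nth_row_shape // -/j E.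
Qed.

(** * Column insertion *)

(* [bumps i w u b]: inserting at position i turns w into u, and b is the letter
   by which the content grows. *)
Inductive bumps : nat -> word -> word -> nat -> Prop :=
| bumps_new w : bumps (size w) (None :: w) (Some 0 :: w) 0
| bumps_hit i w u b :
    bumps i w u b -> bumps i (Some b :: w) (Some b.+1 :: u) b.+1
| bumps_miss i a w u b :
    bumps i w u b -> a != Some b -> bumps i (a :: w) (a :: u) b.

Lemma bumps_size (i : nat) (w u : word) (b : nat) :
  bumps i w u b -> size u = size w /\ i < size w.
Proof. by elim=> {i w u b} /= [w|i w u b _ [-> ?]|i a w u b _ [-> ?] _]; lia. Qed.

Lemma bumps_cnt (i : nat) (w u : word) (b : nat) :
  bumps i w u b -> forall j, cnt u j = cnt w j + (j == b).
Proof.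
elim=> {i w u b} [w|i w u b _ IH|i a w u b _ IH ab] j;
  rewrite /cnt /= -!/(cnt _ _) ?IH ?(inj_eq Some_inj) //= ?(eq_sym j); lia.
Qed.

Lemma bumps_weight (i : nat) (w u : word) (b : nat) :
  bumps i w u b -> count isSome u = (count isSome w).+1.
Proof. by elim=> {i w u b} [w|i w u b _ IH|i a w u b _ IH ab] /=; lia. Qed.

Lemma nth_rev_cons (T : Type) (x0 a : T) (s : seq T) (i : nat) :
  nth x0 (rev (a :: s)) i = if i == size s then a else nth x0 (rev s) i.
Proof.
rewrite rev_cons nth_rcons size_rev.
by case: ltngtP => // h; rewrite nth_default // size_rev ltnW.
Qed.

(** Bumping changes letters but never empties a position, so the occupied positions evolve
    independently of the letters, as the pending left ends of arcs do. *)
Lemma bumps_supp (i : nat) (w u : word) (b p : nat) : bumps i w u b ->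
  nth None (rev w) i = None /\
  isSome (nth None (rev u) p) = isSome (nth None (rev w) p) || (p == i).
Proof.
elim=> {i w u b} [w|i w u b bu [e1 e2]|i a w u b bu [e1 e2] ab];
  rewrite !nth_rev_cons ?eqxx //.
- by case: eqP => //=; rewrite orbF.
- have [-> si] := bumps_size bu; split; first by case: eqP => [?|//]; lia.
  by case: ifP.
- have [-> si] := bumps_size bu; split; first by case: eqP => [?|//]; lia.
  by case: eqP => [->|//]; rewrite (gtn_eqF si) orbF.
Qed.

Lemma bumps_fun (i : nat) (w u u' : word) (b b' : nat) :
  bumps i w u b -> bumps i w u' b' -> u = u' /\ b = b'.
Proof.
move=> h; elim: h u' b' => {i w u b} [w|i w u b bu IH|i a w u b bu IH ab] u' b' h.
- by inversion h as [?|? ? ? ? bu'|? ? ? ? ? bu' ab']; subst => //; have := bumps_size bu'; lia.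
- inversion h as [?|? ? ? ? bu'|? ? ? ? ? bu' ab']; subst; have [? ?] := IH _ _ bu'; subst => //.
  by rewrite eqxx in ab'.
- inversion h as [?|? ? ? ? bu'|? ? ? ? ? bu' ab']; subst; first by have := bumps_size bu; lia.
    by have [? ?] := IH _ _ bu'; subst; rewrite eqxx in ab.
  by have [? ?] := IH _ _ bu'; subst.
Qed.

(** Read u from its latest letter: a letter b was b - 1 before, or the blank at i if b = 0, and any
    other letter is unchanged. After a change the search goes on with b - 1, so every step is
    forced. *)
Lemma bumps_inj (i i' : nat) (w w' u : word) (b : nat) :
  bumps i w u b -> bumps i' w' u b -> i = i' /\ w = w'.
Proof.
move=> h; elim: h i' w' => {i w u b} [w|i w u b bu IH|i a w u b bu IH ab] i' w' h.
- by inversion h as [?|? ? ? ? bu'|? ? ? ? ? bu' ab']; subst.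
- by inversion h as [?|? ? ? ? bu'|? ? ? ? ? bu' ab']; subst;
    [have [? ?] := IH _ _ bu'; subst | rewrite eqxx in ab'].
- inversion h as [?|? ? ? ? bu'|? ? ? ? ? bu' ab']; subst; try by rewrite eqxx in ab.
  by have [? ?] := IH _ _ bu'; subst.
Qed.

Lemma bumps_total (i : nat) (w : word) :
  i < size w -> nth None (rev w) i = None -> exists u b, bumps i w u b.
Proof.
elim: w => //= a w IH; rewrite ltnS nth_rev_cons leq_eqVlt.
case: eqP => [-> _ ->|_ /= /IH h /h [u [b bu]]]; first by exists (Some 0 :: w), 0; constructor.
have [->|ab] := eqVneq a (Some b).
  by exists (Some b.+1 :: u), b.+1; constructor.
by exists (a :: u), b; constructor.
Qed.

(** Reverse insertion: the last b becomes b - 1, the last b - 1 before it becomes b - 2, and so on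
    until a 0 becomes a blank. The lattice condition supplies each earlier letter. *)
Lemma bumps_cototal (u : word) (b : nat) :
  lattice u -> 0 < cnt u b -> exists i w, bumps i w u b.
Proof.
elim: u b => //= a u IH b /andP[lu ha]; rewrite /cnt /= -/(cnt _ _).
have [ea _|ab] := eqVneq a (Some b); last first.
  by move=> /(IH _ lu)[i [w bu]]; exists i, (a :: w); constructor.
subst; case: b ha => [|b] ha; first by exists (size u), (None :: u); constructor.
have [|i [w bu]] := IH b lu; first exact: leq_ltn_trans ha.
by exists i, (Some b :: w); constructor.
Qed.

(** In a prefix only the count of the current b grows, by one. This can spoil the test only for a
    next letter equal to b, and such a letter is bumped. *)
Lemma bumps_lattice (i : nat) (w u : word) (b : nat) :
  bumps i w u b -> lattice w -> lattice u.
Proof.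
elim=> {i w u b} //= [i w u b bu IH|i a w u b bu IH ab] /andP[lw ha]; rewrite IH //=.
  by rewrite !(bumps_cnt bu) eqxx; have := lattice_cnt b lw; case: eqP => ?; lia.
case: a ab ha => [[|d]|] //; rewrite (inj_eq Some_inj) => ab ha.
by rewrite !(bumps_cnt bu) (negPf ab); lia.
Qed.

(** The inequality says that the last box of column b is a removable corner, so that the counts of w
    still decrease. *)
Lemma lattice_bumps (i : nat) (w u : word) (b : nat) :
  bumps i w u b -> lattice u -> cnt u b.+1 < cnt u b -> lattice w.
Proof.
elim=> {i w u b} /= [w|i w u b bu IH|i a w u b bu IH ab] /andP[lu ha].
- by rewrite lu.
(* For the shorter prefix, the corner hypothesis is the lattice test passed by the letter b + 1. *)
- move=> _; rewrite IH //=; case: b bu IH ha => //= b bu _ _.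
  have := lattice_cnt b lu; rewrite !(bumps_cnt bu) eqxx.
  by case: eqP => ?; lia.
- rewrite /cnt /= -!/(cnt _ _) (negPf ab) => hc; rewrite IH //=; last first.
    by case: eqP hc => _; lia.
  case: a ab ha hc => [[|d]|] //; rewrite !(inj_eq Some_inj) => ab.
  rewrite !(bumps_cnt bu) !eqxx (gtn_eqF (ltnSn b)) (negPf ab).
  rewrite eqSS; case: (eqVneq d b) => [->|_] /=; rewrite -?[count_mem _ _]/(cnt _ _) => *; lia.
Qed.

(* The number of 0s at positions below s. *)
Fixpoint zeros (s : nat) (w : word) : nat :=
  if w is a :: w' then ((size w' < s) && (a == Some 0)) + zeros s w' else 0.

Lemma zeros_mono (s t : nat) (w : word) : s <= t -> zeros s w <= zeros t w.
Proof. by move=> st; elim: w => //= a w IH; lia. Qed.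

Lemma zeros_all (s : nat) (w : word) : size w <= s -> zeros s w = cnt w 0.
Proof. by elim: w => //= a w IH h; rewrite /cnt /= h IH // ltnW. Qed.

(** A 0 appears at i and the next 0 to its right disappears. Up to the latter the new count is the
    count before i plus one; beyond it the count is the old one, which is at least as large. The
    maximum covers both cases. *)
Lemma bumps_zeros (i : nat) (w u : word) (b : nat) : bumps i w u b ->
  forall s, zeros s u = if i < s then maxn (zeros s w) (zeros i w).+1 else zeros s w.
Proof.
elim=> {i w u b} /= [w|i w u b bu IH|i a w u b bu IH ab] s.
- rewrite ltnn /= andbF andbT /=; case: ltnP => // ws.
  by rewrite !zeros_all ?(ltnW ws) //; lia.
- have [su iw] := bumps_size bu; rewrite su andbF add0n IH [size w < i]ltnNge (ltnW iw) /=.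
  case: ltnP => is_; last by rewrite (ltnNge (size w)) (leq_trans is_ (ltnW iw)).
  (* Whether b is 0 tells whether a 0 has already been bumped, hence which term is the maximum. *)
  have := bumps_cnt bu 0.
  rewrite -[cnt u 0](@zeros_all (size w)) ?su // IH iw.
  rewrite -[cnt w 0](@zeros_all (size w)) // (inj_eq Some_inj).
  have := @zeros_mono i s w (ltnW is_).
  have : zeros s w <= zeros (size w) w.
    rewrite [zeros (size w) w]zeros_all // -(@zeros_all (maxn s (size w))) ?zeros_mono //; lia.
  by case: b {bu IH} => [|b] /=; lia.
- have [su iw] := bumps_size bu; rewrite su IH (ltnNge (size w) i) (ltnW iw) /=.
  case: ifP => // is_; case: (ltnP (size w) s) => //= ws.
  have [ea|//] := eqVneq a (Some 0); move: ab; rewrite ea (inj_eq Some_inj) => b0.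
  have := bumps_cnt bu 0; rewrite (negPf b0) -(@zeros_all s) ?su 1?ltnW //.
  rewrite IH is_ -(@zeros_all s w) 1?ltnW //; lia.
Qed.

(** * Growth of a diagram into a sequence of shapes *)

(* [growth ps w l]: [ps] lists, latest vertex first, the left end of the arc
   closed at each vertex, [w] is the word after the last vertex, and [l] is the
   tableau, last shape first. *)
Inductive growth : seq (option nat) -> word -> seq (seq nat) -> Prop :=
| growth_nil : growth [::] [::] [:: [::]]
| growth_open ps w l j :
    growth ps w l -> lattice (Some j :: w) ->
    growth (None :: ps) (Some j :: w)
      [:: row_shape (Some j :: w), row_shape w & l]
| growth_close ps w l x i u b :
    growth ps w l -> lattice u -> bumps i u (x :: w) b ->
    growth (Some i :: ps) u
      [:: row_shape u,
          (if x is None then row_shape u else row_shape (x :: w)) & l].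

Lemma growth_lattice ps w l : growth ps w l -> lattice w.
Proof. by case. Qed.

Lemma growth_head ps w l :
  growth ps w l -> exists l', l = row_shape w :: l'.
Proof. by case=> * /=; eexists. Qed.

Lemma growth_size ps w l :
  growth ps w l -> size w = size ps /\ size l = (2 * size ps).+1.
Proof.
elim=> {ps w l} //= [ps w l j _ [-> ->] _|ps w l x i u b _ [e ->] _ /bumps_size[/= e' _]]; lia.
Qed.

(** Read backwards, the head of [ps] selects the rule, and insertion determines the previous
    word. *)
Lemma growth_fun ps w l l' : growth ps w l -> growth ps w l' -> l = l'.
Proof.
move=> g; elim: g l' => {ps w l} [|ps w l j g IH lj|ps w l x i u b g IH lu bu] l' g'.
- by inversion g'.
- by inversion g' as [|? ? l1 ? g1 _|]; subst; rewrite (IH _ g1).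
- inversion g' as [| |? w1 l1 x1 ? ? b1 g1 _ bu1]; subst.
  have [[? ?] ?] := bumps_fun bu bu1; subst.
  by rewrite (IH _ g1).
Qed.

(** The weights of the last three shapes tell which rule was applied and whether x is a blank. The
    differences of column counts give the letters, and reverse insertion does the rest. *)
Lemma growth_inj ps ps' w w' l :
  growth ps w l -> growth ps' w' l -> ps = ps' /\ w = w'.
Proof.
have cons_inj (j j' : nat) v : lattice (Some j :: v) -> lattice (Some j' :: v) ->
    row_shape (Some j :: v) = row_shape (Some j' :: v) -> j = j'.
  move=> lj lj' /(row_shape_cnt lj lj') /(_ j); rewrite /cnt /= eqxx.
  by rewrite (inj_eq Some_inj); case: (eqVneq j' j) => // _; lia.
have weightE v v' : row_shape v = row_shape v' -> count isSome v = count isSome v'.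
  by rewrite -!sumn_row_shape => ->.
(* The letter b is where the counts of u exceed those of v, so equal shapes of v and v' give equal
   letters. *)
have bumps_det i i' v v' u b b' : lattice v -> lattice v' -> row_shape v = row_shape v' ->
    bumps i v u b -> bumps i' v' u b' -> i = i' /\ v = v'.
  move=> lv lv' /(row_shape_cnt lv lv') e bu bu'; suff eb : b = b'.
    by rewrite -eb in bu'; apply: bumps_inj bu bu'.
  have := bumps_cnt bu b'; have := bumps_cnt bu' b'; rewrite e eqxx.
  by case: eqP => // _; lia.
move=> g; elim: g ps' w' => {ps w l} [|ps w l j g IH lj|ps w l x i u b g IH lu bu] ps' w' g'.
- by inversion g'.
- inversion g' as [|ps1 w1 l1 j1 g1 lj1 e1 e2 [e3 e4 e5]|ps1 w1 l1 x1 i1 u1 b1 g1 lu1 bu1 e1 e2 [e3 e4 e5]]; subst.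
    have [? ?] := IH _ _ g1; subst.
    by have -> := cons_inj _ _ _ lj1 lj e3.
  have [? ?] := IH _ _ g1; subst.
  have h := bumps_weight bu1; case: x1 h e4 bu1 g' => [j1|] /= h e4 bu1 g'.
    by have := weightE (Some j1 :: w1) w1 e4 => /=; lia.
  by have := weightE _ _ e4 => /=; lia.
- inversion g' as [|ps1 w1 l1 j1 g1 lj1 e1 e2 [e3 e4 e5]|ps1 w1 l1 x1 i1 u1 b1 g1 lu1 bu1 e1 e2 [e3 e4 e5]]; subst.
    have [? ?] := IH _ _ g1; subst.
    have h := bumps_weight bu; case: x h e4 bu g' => [j2|] /= h e4 bu g'.
      by have := weightE w1 (Some j2 :: w1) e4 => /=; lia.
    by have := weightE w1 (Some j1 :: w1) e4 => /=; lia.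
  have [? ?] := IH _ _ g1; subst.
  suff ? : x = x1 by subst; have [-> ->] := bumps_det _ _ _ _ _ _ _ lu1 lu e3 bu1 bu.
  have h := bumps_weight bu; have h1 := bumps_weight bu1.
  case: x x1 h h1 e4 bu bu1 g' => [j|] [j1|] //= h h1 e4 bu bu1 g'.
  - congr Some; apply: (cons_inj j j1 w1) => //.
    + exact: bumps_lattice bu lu.
    + exact: bumps_lattice bu1 lu1.
  - by have := weightE _ (Some j :: w1) e4 => /=; have := weightE _ _ e3; lia.
  - by have := weightE (Some j1 :: w1) _ e4 => /=; have := weightE _ _ e3; lia.
Qed.

(** Shapes are listed from the last one and consumed two at a time, to match the rules of
    [growth]. *)
Fixpoint hesitating (l : seq (seq nat)) : bool :=
  match l with
  | nu :: mu :: (la :: _) as l' => hesitating_moves la mu nu && hesitating l'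
  | [:: la] => la == [::]
  | _ => false
  end.

Lemma hesitating_cons la mu nu l :
  hesitating [:: nu, mu, la & l] = hesitating_moves la mu nu && hesitating (la :: l).
Proof. by []. Qed.

Lemma hesitatingP (n : nat) (l : seq (seq nat)) : size l = (2 * n).+1 ->
  hesitating l <->
  (nth [::] (rev l) 0 = [::] /\
   forall i, i < n ->
     hesitating_moves (nth [::] (rev l) (2 * i)) (nth [::] (rev l) (2 * i).+1)
       (nth [::] (rev l) (2 * i).+2)).
Proof.
elim: n l => [|n IH] [|nu [|mu [|la l]]] //= sl; try lia.
  by split=> [/eqP ->|[/= ->]].
have sl' : size (la :: l) = (2 * n).+1 by rewrite /=; lia.
have sl2 : size l = 2 * n by case: sl'.
have nthE i : i < (2 * n).+1 -> nth [::] (rev [:: nu, mu, la & l]) i = nth [::] (rev (la :: l)) i.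
  by move=> h; rewrite (nth_rev_cons _ nu) (nth_rev_cons _ mu) /= sl2 !ltn_eqF //; lia.
have n0 : nth [::] (rev [:: nu, mu, la & l]) (2 * n) = la.
  by rewrite nthE // nth_rev_cons sl2 eqxx.
have n1 : nth [::] (rev [:: nu, mu, la & l]) (2 * n).+1 = mu.
  by rewrite !nth_rev_cons /= sl2 eqxx; case: eqP => //; lia.
have n2 : nth [::] (rev [:: nu, mu, la & l]) (2 * n).+2 = nu.
  by rewrite nth_rev_cons /= sl2 eqxx.
split=> [/andP[h /(IH _ sl')[h0 hi]]|[h0 hi]].
  split=> [|i]; first by rewrite nthE.
  rewrite ltnS leq_eqVlt => /orP[/eqP ->|li]; first by rewrite n0 n1 n2.
  by rewrite !nthE //; try lia; apply: hi.
apply/andP; split; first by have := hi n (ltnSn n); rewrite n0 n1 n2.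
apply/(IH _ sl'); split=> [|i li]; first by rewrite -nthE.
by have := hi i (ltnW li); rewrite !nthE //; lia.
Qed.

(** Opening gives stay then add; closing gives remove then stay if x is a blank, and add then remove
    if x is a letter. Each removal is an insertion read backwards. *)
Lemma growth_hesitating ps w l :
  growth ps w l -> hesitating l /\ all ferrers l.
Proof.
elim=> {ps w l} [|ps w l j g [hl fl] lj|ps w l x i u b g [hl fl] lu bu] //.
  have [l' el] := growth_head g; have lw := growth_lattice g; subst.
  rewrite hesitating_cons hl andbT /hesitating_moves eqxx.
  split; last by apply/and3P; split=> //; apply: ferrers_row_shape.
  by rewrite (row_shape_add_box (j := j) lw lj) // => d;
    rewrite /cnt /= (inj_eq Some_inj) eq_sym; lia.
have [l' el] := growth_head g; have lw := growth_lattice g; subst.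
have lxw := bumps_lattice bu lu.
have rb : remove_box (row_shape (x :: w)) (row_shape u).
  by apply: (row_shape_add_box (j := b)) => // d; rewrite (bumps_cnt bu).
rewrite hesitating_cons hl andbT /hesitating_moves.
split; last by apply/and3P; split=> //; [|case: (x) lxw => [j|] lxw]; apply: ferrers_row_shape.
case: x bu lxw rb => [j|] bu lxw rb; last by rewrite eqxx rb orbT.
apply/orP; right; apply/orP; right; rewrite rb andbT.
apply: (row_shape_add_box (j := j) lw lxw) => d.
by rewrite /cnt /= (inj_eq Some_inj) eq_sym; lia.
Qed.

Lemma remove_box_bumps (w : word) (mu : seq nat) :
  lattice w -> ferrers mu -> remove_box (row_shape w) mu ->
  exists i u b, [/\ bumps i u w b, lattice u & row_shape u = mu].
Proof.
move=> lw fmu /add_boxP[r lr emu].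
have e i : nth 0 (row_shape w) i = (r == i) + nth 0 mu i by rewrite emu nth_incr_nth.
(* The removed box lies in row r and column j. It ends both: [cj] says so for the column, and [cj1]
   makes it a corner, as [lattice_bumps] requires. *)
pose j := nth 0 mu r.
have cj : cnt w j = r.+1.
  have h i : (i < cnt w j) = (i < r.+1).
    rewrite -nth_row_shape //; case: (ltnP i r.+1) => [ir|ri].
      have := ferrers_nth (ferrers_row_shape lw) (ir : i <= r).
      by rewrite (e r) eqxx /j; lia.
    by rewrite e (ltn_eqF ri) /j ltnNge add0n (ferrers_nth fmu (ltnW ri)).
  by have := h r.+1; have := h (cnt w j); lia.
have cj1 : cnt w j.+1 <= r.
  by rewrite leqNgt -nth_row_shape // e eqxx /j; lia.
have [|i [u bu]] := @bumps_cototal w j lw; first by rewrite cj.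
have lu : lattice u by apply: lattice_bumps bu lw _; rewrite cj ltnS.
exists i, u, j; split=> //; apply: ferrers_nth_inj (ferrers_row_shape lu) fmu _ => q.
have h p : (p < nth 0 (row_shape u) q) = (p < nth 0 mu q).
  rewrite nth_row_shape //; have := nth_row_shape q p lw; rewrite (bumps_cnt bu) e.
  have := bumps_cnt bu j; rewrite cj eqxx addn1 => -[cu].
  case: (eqVneq p j) => [->|pj]; last first.
    rewrite addn0 => <-; case: (eqVneq r q) => [eq|_]; last by [].
    by move: pj; rewrite -eq /j; lia.
  rewrite -cu; case: (eqVneq r q) => [<-|rq]; rewrite /j; first by rewrite !ltnn.
  by move: rq; rewrite addn1 ltnS add0n; case: (ltngtP q r) => // [_ _ <-|_ _ <-|->]; rewrite ?eqxx //; lia.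
by have := h (nth 0 mu q); have := h (nth 0 (row_shape u) q); lia.
Qed.

Lemma growth_total (n : nat) (l : seq (seq nat)) : size l = (2 * n).+1 ->
  hesitating l -> all ferrers l -> exists ps w, growth ps w l.
Proof.
elim: n l => [|n IH] [|nu [|mu [|la l]]] //= sl; try lia.
  by move=> /eqP -> _; exists [::], [::]; constructor.
have sl' : size (la :: l) = (2 * n).+1 by rewrite /=; lia.
move=> /andP[hm hl] /and4P[fnu fmu fla fl].
have [|ps [w g]] := IH _ sl' hl; first by rewrite /= fla.
have lw := growth_lattice g; have [l' [el _]] := growth_head g; subst la.
case/or3P: hm => /andP[].
- move=> /eqP -> /(add_box_letter lw fnu)[j lj <-].
  by exists (None :: ps), (Some j :: w); constructor.
- move=> rb /eqP ->.
  (* The vertex opens no arc: a blank is appended, which keeps the shape, and the reverse insertion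
     acts on the longer word. *)
  have [//|//|i [u [b [bu lu eu]]]] := @remove_box_bumps (None :: w) mu _ _ rb.
    by rewrite /= lw.
  by exists (Some i :: ps), u; rewrite -eu; apply: (growth_close g lu bu).
- move=> /(add_box_letter lw fmu)[j lj <-] rb.
  have [i [u [b [bu lu <-]]]] := remove_box_bumps lj fnu rb.
  by exists (Some i :: ps), u; apply: (growth_close g lu bu).
Qed.

(** * Arc diagrams encoded by sequences of left ends *)

Definition arcs (ps : seq (option nat)) : pred (nat * nat) :=
  fun a => nth None (rev ps) a.2 == Some a.1.

(* The pairs (ss, ps) that encode open partition diagrams: ss marks the left
   ends of open arcs, and an isolated vertex v has the arc (v, v). *)
Record matching (ss : seq bool) (ps : seq (option nat)) : Prop := Matching {
  matching_size : size ss = size ps;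
  matching_arc i v : arcs ps (i, v) -> i <= v /\ nth false (rev ss) i = false;
  matching_inj i u v : arcs ps (i, u) -> arcs ps (i, v) -> u = v;
  matching_cover v : v < size ps -> nth None (rev ps) v = None ->
    nth false (rev ss) v \/ exists u, arcs ps (v, u)
}.

Lemma arcs_lt ps (a : nat * nat) : arcs ps a -> a.2 < size ps.
Proof.
rewrite /arcs; case: (ltnP a.2 (size ps)) => // h.
by rewrite nth_default // size_rev.
Qed.

Lemma arcs_cons p ps (a : nat * nat) :
  arcs (p :: ps) a = (if a.2 == size ps then p == Some a.1 else arcs ps a).
Proof. by rewrite /arcs nth_rev_cons; case: ifP. Qed.

(** An arc ends at or after its left end, so one that starts at the last vertex would have to end
    there. Without it, covering forces this vertex to be open. *)
Lemma matching_open (s : bool) ss ps :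
  matching (s :: ss) (None :: ps) <-> s /\ matching ss ps.
Proof.
have arcsE a : arcs (None :: ps) a = arcs ps a.
  rewrite arcs_cons; case: eqP => // e; apply/esym/negP => /arcs_lt.
  by rewrite e ltnn.
split=> [[[sz] arc inj cov]|[hs [sz arc inj cov]]].
  have lt v i : arcs ps (i, v) -> i < size ss.
    move=> h; rewrite sz; have := arcs_lt h => /=; apply: leq_ltn_trans.
    by case: (arc i v); rewrite ?arcsE.
  split.
    have [] := cov (size ps); rewrite ?nth_rev_cons ?eqxx ?sz ?eqxx //=.
    by case=> u; rewrite arcsE => /lt; rewrite sz ltnn.
  split=> // [i v h|i u v h h'|v lv pv].
  - have := arc i v; rewrite arcsE nth_rev_cons (ltn_eqF (lt _ _ h)); exact.
  - by apply: (inj i); rewrite arcsE.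
  - have := cov v (ltnW lv); rewrite !nth_rev_cons sz (ltn_eqF lv) pv.
    by case=> // [|[u hu]]; [left|right; exists u; rewrite -arcsE].
split=> /= [|i v|i u v|v]; rewrite ?sz //.
- rewrite arcsE => h; have [iv hi] := arc _ _ h; split=> //.
  by rewrite nth_rev_cons sz ltn_eqF // (leq_ltn_trans iv (arcs_lt h)).
- by rewrite !arcsE; apply: inj.
- rewrite !nth_rev_cons sz ltnS leq_eqVlt; case: eqP => [-> _ _|_ /= lv pv]; first by left.
  by have [|[u hu]] := cov v lv pv; [left|right; exists u; rewrite arcsE].
Qed.

(** Forgetting the last vertex turns its arc into an open arc at i. The bit [s] belongs to the
    forgotten vertex; it absorbs the new mark when the arc is degenerate and i is that vertex. *)
Lemma matching_close i (ss : seq bool) (s : bool) ss' ps : size ss = (size ss').+1 ->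
  (forall v, nth false (rev (s :: ss')) v = nth false (rev ss) v || (v == i)) ->
  matching ss (Some i :: ps) <->
  [/\ i <= size ps, nth false (rev ss) i = false & matching ss' ps].
Proof.
move=> szs sE.
split=> [[sz arc inj cov]|[li hi [sz arc inj cov]]].
  have sz' : size ss' = size ps by move: sz szs => /= -> [].
  have new : arcs (Some i :: ps) (i, size ps) by rewrite arcs_cons /= eqxx.
  have [li hi] := arc _ _ new.
  have old a : arcs ps a -> arcs (Some i :: ps) a.
    by move=> h; rewrite arcs_cons (ltn_eqF (arcs_lt h)).
  split=> //; split=> // [j v h|j u v h h'|v lv pv].
  - have [jv hj] := arc _ _ (old _ h); split=> //; have := sE j.
    rewrite hj nth_rev_cons sz' ltn_eqF ?(leq_ltn_trans jv (arcs_lt h)) // => ->.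
    apply/eqP => ej; subst; have := inj _ _ _ (old _ h) new => ev.
    by have := arcs_lt h; rewrite /= ev ltnn.
  - by apply: (inj j); apply: old.
  - have := sE v; rewrite nth_rev_cons sz' (ltn_eqF lv) => ->.
    have := cov v (ltnW lv); rewrite nth_rev_cons (ltn_eqF lv) => /(_ pv)[->|[u]].
      by left.
    rewrite arcs_cons /=; case: eqP => [_ /eqP[->]|_ h]; last by right; exists u.
    by rewrite eqxx orbT; left.
have sz2 : size ss = (size ps).+1 by rewrite szs sz.
have oldE j v : arcs (Some i :: ps) (j, v) ->
    (v = size ps /\ j = i) \/ [/\ arcs ps (j, v), j <= v, j != i & nth false (rev ss) j = false].
  rewrite arcs_cons /=; case: eqP => [-> /eqP[->]|_ h]; first by left.
  right; have [jv hj] := arc _ _ h; have := sE j.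
  rewrite nth_rev_cons sz ltn_eqF ?(leq_ltn_trans jv (arcs_lt h)) // hj.
  by case: (nth false (rev ss) j); case: (eqVneq j i).
split=> //= [j v /oldE[[-> ->]|[]]|j u v|v] //.
- case/oldE=> [[-> ->]|[h _ /negP ji _]] /oldE[[ev ej]|[h' _ /negP ji' _]] //; last exact: inj h h'.
  by case: ji; apply/eqP.
- rewrite nth_rev_cons ltnS leq_eqVlt; case: eqP => //= _ lv pv.
  have := cov v lv pv; have := sE v; rewrite nth_rev_cons sz (ltn_eqF lv) => ->.
  case=> [/orP[|/eqP ->]|[u hu]]; first by left.
    by right; exists (size ps); rewrite arcs_cons /= eqxx.
  by right; exists u; rewrite arcs_cons /= (ltn_eqF (arcs_lt hu)).
Qed.

Definition occupied (w : word) : seq bool := map isSome w.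

Lemma nth_occupied (w : word) v :
  nth false (rev (occupied w)) v = isSome (nth None (rev w) v).
Proof.
rewrite /occupied -map_rev; case: (ltnP v (size w)) => h.
  by rewrite (nth_map None) // size_rev.
by rewrite !nth_default // ?size_map size_rev.
Qed.

Lemma growth_matching ps w l : growth ps w l -> matching (occupied w) ps.
Proof.
elim=> {ps w l} [|ps w l j g IH lj|ps w l x i u b g IH lu bu].
- by split=> // i v; rewrite /arcs nth_nil.
- by rewrite /= matching_open.
- have [/= sz iu] := bumps_size bu; have [sw _] := growth_size g.
  apply/(@matching_close i _ (isSome x) (occupied w)).
  + by rewrite !size_map sz.
  + by move=> v; rewrite -[_ :: _]/(occupied (x :: w)) !nth_occupied; have [_ ->] := bumps_supp v bu.
  split=> //; first by rewrite -sw -ltnS sz.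
  by rewrite nth_occupied; have [->] := bumps_supp 0 bu.
Qed.

(** The scan from right to left never gets stuck: in a matching the left end i is in range and
    blank, which is all that insertion needs. *)
Lemma matching_growth ps w :
  lattice w -> matching (occupied w) ps -> exists l, growth ps w l.
Proof.
elim: ps w => [|p ps IH] w lw mw.
  by move: (matching_size mw); rewrite size_map; case: w {lw mw} => // _; exists [:: [::]]; constructor.
case: p mw => [i|] mw; last first.
  case: w lw mw => [_ /matching_size //|x w lw /matching_open[hx mw]].
  case: x hx lw => // j _ lj; have [|l g] := IH w _ mw; first by case/andP: lj.
  by eexists; apply: (growth_open g lj).
have si := matching_size mw; rewrite size_map /= in si.
have iarc : arcs (Some i :: ps) (i, size ps) by rewrite arcs_cons /= eqxx.
have [li] := matching_arc mw iarc; rewrite nth_occupied => hi.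
have hi' : nth None (rev w) i = None by case: nth hi.
have [|[|x u] [b bu]] := @bumps_total i w _ hi'; first by rewrite si.
  by case: (bumps_size bu); rewrite si.
have [/= sz _] := bumps_size bu.
have [||_ _ mu] := (@matching_close i (occupied w) (isSome x) (occupied u) ps _ _).1 mw.
- by rewrite !size_map -sz.
- by move=> v; rewrite -[_ :: _]/(occupied (x :: u)) !nth_occupied; have [_ ->] := bumps_supp v bu.
have [|l g] := IH u _ mu; first by have /andP[] := bumps_lattice bu lw.
by eexists; apply: (growth_close g lw bu).
Qed.

(** * Heights and nestings *)

Definition inside (a c : nat * nat) : bool := (c.1 < a.1) && (a.2 < c.2).

Lemma inside_trans : transitive inside.
Proof. by move=> b a c /andP[? ?] /andP[? ?]; apply/andP; split; lia. Qed.

(* Nestings are listed from the innermost arc outwards. *)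
Definition nesting (A : pred (nat * nat)) (s : nat) (c : seq (nat * nat)) : bool :=
  sorted inside c && all (fun a => A a && (a.1 < s)) c.

Definition has_nesting (A : pred (nat * nat)) (s r : nat) : Prop :=
  exists2 c, size c = r & nesting A s c.

(** The innermost arc has the largest left end, so the bound s concerns it alone and becomes a.1 for
    the others. *)
Lemma nesting_cons A s a c :
  nesting A s (a :: c) =
  [&& A a, a.1 < s, all (inside a) c & nesting A a.1 c].
Proof.
rewrite /nesting /= path_sortedE; last exact: inside_trans.
apply/idP/idP => [/andP[/andP[h1 h2] /andP[/andP[h3 h4] h5]]|/and5P[h1 h2 h3 h4 h5]].
  rewrite h1 h2 h3 h4 /=; apply/allP => x xc.
  by have /andP[-> _] := allP h5 _ xc; have /andP[-> _] := allP h1 _ xc.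
rewrite h1 h2 h3 h4 /=; apply/allP => x xc.
by have /andP[-> h] := allP h5 _ xc; apply: ltn_trans h2.
Qed.

Lemma nesting_sub (A B : pred (nat * nat)) s t c :
  (forall a, a \in c -> A a -> a.1 < s -> B a && (a.1 < t)) ->
  nesting A s c -> nesting B t c.
Proof.
rewrite /nesting => h /andP[-> /allP hc]; apply/allP => a ac.
by have /andP[h1 h2] := hc _ ac; apply: h.
Qed.

(** Since parts of nestings are nestings, this makes [zeros s w] the largest size of a nesting of
    arcs in A with left ends below s. *)
Definition measures (A : pred (nat * nat)) (w : word) : Prop :=
  forall s r, s <= size w -> r <= zeros s w <-> has_nesting A s r.

(** The new arc has the smallest right end, so in a nesting it can only be innermost. The others
    then have left ends below i, which gives the term [(zeros i w).+1] of [bumps_zeros]. *)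
Lemma measures_bumps (A : pred (nat * nat)) i v w u b :
  (forall a, A a -> v < a.2) -> measures A w -> bumps i w u b ->
  measures (predU1 (i, v) A) u.
Proof.
move=> hA mw bu s r; have [-> iw] := bumps_size bu => sw.
have AA c t : nesting A t c -> nesting (predU1 (i, v) A) t c.
  by apply: nesting_sub => a _ ha ->; rewrite /= ha orbT.
rewrite (bumps_zeros bu); split.
  have old : r <= zeros s w -> has_nesting (predU1 (i, v) A) s r.
    by case/(mw s r sw) => c sc /AA; exists c.
  case: ltnP => // is_; rewrite leq_max => /orP[//|].
  case: r {old} => [|r] hr; first by exists [::].
  have [c sc nc] := (mw i r (ltnW iw)).1 hr.
  exists ((i, v) :: c); rewrite /= ?sc // nesting_cons /= eqxx is_ (AA _ _ nc) andbT.
  apply/allP => a ac; have /andP[_ /allP /(_ _ ac) /andP[h1 h2]] := nc.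
  by rewrite /inside h2 hA.
case=> c sc nc.
have [ic|nic] := boolP ((i, v) \in c); last first.
  have : r <= zeros s w.
    apply/(mw s r sw); exists c => //; apply: nesting_sub nc => a ac + ->.
    by case/orP => [/eqP e|->//]; rewrite -e ac in nic.
  by case: ltnP => // _ h; rewrite leq_max h.
case: c ic nc sc => // a c; rewrite inE nesting_cons => ic /and4P[ha as_ ac nc] sc.
have ea : a = (i, v).
  case/orP: ha => [/eqP //|/hA va].
  case/orP: ic => [/eqP //|/(allP ac) /andP[_ /=]]; lia.
subst a; rewrite as_ leq_max -sc; apply/orP; right.
apply/(mw i (size c) (ltnW iw)); exists c => //.
apply: nesting_sub nc => x xc + ->; case/orP => [/eqP e|->//].
by have := allP ac _ xc; rewrite e /inside ltnn.
Qed.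

Lemma measures_behead A x w : measures A (x :: w) -> measures A w.
Proof.
move=> m s r sw; rewrite -(m s r) /=; last exact: leqW.
by rewrite ltnNge sw.
Qed.

Lemma has_nesting_eq (A B : pred (nat * nat)) s r :
  A =1 B -> has_nesting A s r <-> has_nesting B s r.
Proof.
by move=> e; split=> -[c sc nc]; exists c => //; apply: nesting_sub nc => a _;
  rewrite e => -> ->.
Qed.

(** If the innermost arc starts at v, it ends at v or later and so belongs to A, as do the arcs
    around it, and w measures the nesting. Otherwise all left ends are below v. *)
Lemma has_nesting_split (A B : pred (nat * nat)) v w k :
  measures A w -> size w = v.+1 -> (forall a, A a -> v <= a.2) ->
  (forall a, B a -> a.1 <= a.2 < v) ->
  has_nesting (predU A B) v.+1 k.+1 <->
  k < cnt w 0 \/ has_nesting (predU A B) v k.+1.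
Proof.
move=> mw sw hA hB; rewrite -(@zeros_all v.+1) ?sw //; split; last first.
  case=> [/mw|[c sc nc]]; last first.
    by exists c => //; apply: nesting_sub nc => a _ -> /ltnW.
  rewrite sw => /(_ (leqnn _)) [c sc nc]; exists c => //.
  by apply: nesting_sub nc => a _ /= -> ->.
case=> -[|a c] //= sc; rewrite nesting_cons => /and4P[ha av ac nc].
have [lav|lva] := ltnP a.1 v.
  by right; exists (a :: c); rewrite // nesting_cons ha lav ac.
left; apply/mw; rewrite ?sw //; exists (a :: c) => //.
have {}ha : A a by case/orP: ha => // /hB; lia.
rewrite nesting_cons ha av ac; apply: nesting_sub nc => x xc + ->.
by case/orP => [->//|/hB]; have := allP ac _ xc; have := hA _ ha; rewrite /inside; lia.
Qed.

(** In the induction A collects the arcs already scanned. The first column of the word before the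
    deletion of its last letter is the longest one at each vertex, and it measures the nestings with
    left ends up to that vertex. *)
Lemma growth_height k ps w l (A : pred (nat * nat)) :
  growth ps w l -> measures A w -> (forall a, A a -> size ps <= a.2) ->
  all (fun la => size la <= k) l <->
  ~ has_nesting (predU A (arcs ps)) (size ps) k.+1.
Proof.
move=> g; elim: g A => {ps w l} [|ps w l j g IH lj|ps w l x i u b g IH lu bu] A mw hA.
- by split=> // _ [[|a c] //= _]; rewrite nesting_cons; case/and4P.
- have [sw _] := growth_size g; have lw := growth_lattice g.
  have arc a : arcs ps a -> a.1 <= a.2 < size ps.
    move=> h; rewrite arcs_lt // andbT; case: a h => i v h.
    by have [] := matching_arc (growth_matching g) h.
  have hA' a : A a -> size ps <= a.2 by move/hA/ltnW.
  have e : predU A (arcs (None :: ps)) =1 predU A (arcs ps).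
    move=> a /=; rewrite arcs_cons; case: (eqVneq a.2 (size ps)) => // ea.
    by congr orb; apply/esym/negP => /arc; rewrite ea ltnn andbF.
  rewrite (has_nesting_eq _ _ e) /= (has_nesting_split _ mw) /= ?sw //.
  have := IH A (measures_behead mw) hA'.
  rewrite -[incr_nth _ _]/(row_shape (Some j :: w)) !size_row_shape //.
  have h : cnt w 0 <= cnt (Some j :: w) 0 by rewrite /cnt /= leq_addl.
  rewrite leqNgt => {}IH; split.
    by case/and3P=> h1 h2 /IH h3 [h4|//]; rewrite h4 in h1.
  move=> hn; have h1 : cnt (Some j :: w) 0 <= k by rewrite leqNgt; apply/negP => ?; apply: hn; left.
  by rewrite -leqNgt h1 (leq_trans h h1) /=; apply/IH => ?; apply: hn; right.
- have [sw _] := growth_size g; have lw := growth_lattice g.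
  have lxw := bumps_lattice bu lu.
  have arc a : arcs ps a -> a.1 <= a.2 < size ps.
    move=> h; rewrite arcs_lt // andbT; case: a h => q v h.
    by have [] := matching_arc (growth_matching g) h.
  pose A' := predU1 (i, size ps) A.
  have hA' a : A' a -> size ps <= a.2 by case/orP=> [/eqP ->//|/hA/ltnW].
  have e : predU A (arcs (Some i :: ps)) =1 predU A' (arcs ps).
    case=> q v /=; rewrite arcs_cons /= xpair_eqE (inj_eq Some_inj) (eq_sym i).
    case: (eqVneq v (size ps)) => [ev|_]; last by rewrite andbF.
    rewrite andbT; suff -> : arcs ps (q, v) = false by rewrite orbF orbC.
    by apply/negP => /arc /=; rewrite ev ltnn andbF.
  have mA' : measures A' (x :: w) by apply: measures_bumps bu => // a /hA.
  have swx : size (x :: w) = (size ps).+1 by rewrite /= sw.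
  rewrite (has_nesting_eq _ _ e) (has_nesting_split k mA' swx hA' arc).
  have {}IH := IH A' (measures_behead mA') hA'.
  have [l' el] := growth_head g.
  have h : cnt u 0 <= cnt (x :: w) 0 by rewrite (bumps_cnt bu) leq_addr.
  (* When x is a blank the middle shape is that of u, but the head of [l], the shape of w, has the
     height of [x :: w]. *)
  have -> : all (fun la => size la <= k)
      [:: row_shape u, if x is None then row_shape u else row_shape (x :: w) & l] =
      (cnt (x :: w) 0 <= k) && all (fun la => size la <= k) l.
    have hw : cnt w 0 <= cnt (x :: w) 0 by rewrite /cnt /= leq_addl.
    rewrite el /=; case: x lxw h hw {bu mA' e swx} => [j|] lxw h hw; last first.
      by rewrite !size_row_shape //; move: h; rewrite {2}/cnt /= -/(cnt _ _) add0n; lia.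
    rewrite -[(_ == _) + _]/(cnt (Some j :: w) 0) -[incr_nth _ _]/(row_shape (Some j :: w)).
    by rewrite !size_row_shape //; lia.
  split.
    by case/andP=> h1 /IH h2 [|//]; rewrite ltnNge h1.
  move=> hn; have h1 : cnt (x :: w) 0 <= k by rewrite leqNgt; apply/negP => ?; apply: hn; left.
  by rewrite h1 /=; apply/IH => ?; apply: hn; right.
Qed.

(** * Words whose shape has at most one row *)

Fixpoint one_row_word (ss : seq bool) : word :=
  if ss is s :: ss' then
    (if s then Some (count id ss') else None) :: one_row_word ss'
  else [::].

Lemma occupied_one_row_word ss : occupied (one_row_word ss) = ss.
Proof. by elim: ss => //= s ss ->; case: s. Qed.

Lemma size_one_row_word ss : size (one_row_word ss) = size ss.
Proof. by rewrite -[in RHS](occupied_one_row_word ss) size_map. Qed.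

Lemma cnt_one_row_word ss j : cnt (one_row_word ss) j = (j < count id ss).
Proof.
elim: ss => //= -[] ss; rewrite /cnt /= -/(cnt _ _) => ->; last by rewrite !add0n.
by rewrite (inj_eq Some_inj); case: ltngtP; lia.
Qed.

Lemma lattice_one_row_word ss : lattice (one_row_word ss).
Proof.
elim: ss => //= -[] ss -> //=.
by case E: (count id ss) => [|c] //; rewrite !cnt_one_row_word E ltnn ltnSn.
Qed.

Lemma row_shape_one_row_word ss : row_shape (one_row_word ss) = one_row (count id ss).
Proof.
have lw := lattice_one_row_word ss.
apply: ferrers_nth_inj; rewrite ?ferrers_row_shape //.
  by rewrite /one_row; case: eqP => // c0; rewrite /ferrers /= inE; lia.
move=> i; have h j : (j < nth 0 (row_shape (one_row_word ss)) i) = (j < (i == 0) * count id ss).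
  by rewrite nth_row_shape // cnt_one_row_word; case: ltnP; case: i => [|i] /=; lia.
have -> : nth 0 (one_row (count id ss)) i = (i == 0) * count id ss.
  by rewrite /one_row; case: eqP => [->|_]; case: i {h} => [|[|i]] //=; lia.
have := h (nth 0 (row_shape (one_row_word ss)) i); have := h ((i == 0) * count id ss); lia.
Qed.

(** Height at most 1 means that no letter is repeated, and the lattice condition forces the order 0,
    1, 2, ... So the blanks determine the word. *)
Lemma one_row_word_occupied w :
  lattice w -> size (row_shape w) <= 1 -> one_row_word (occupied w) = w.
Proof.
move=> lw; rewrite size_row_shape //.
have cE (v : word) j : one_row_word (occupied v) = v -> cnt v j = (j < count isSome v).
  by move=> e; rewrite -{1}e cnt_one_row_word count_map.
elim: w lw => //= a w IH /andP[lw ha]; rewrite {1}/cnt /= -/(cnt _ _) => h.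
have h0 : cnt w 0 <= 1 by lia.
have {}IH := IH lw h0; rewrite IH; case: a ha h => [j|] //= ha h; congr (Some _ :: _).
rewrite count_map; have {}IH j' := cE _ j' IH.
case: j ha h => [|j] ha h.
  by rewrite eqxx in h; have := IH 0; case: (count _ w) => //= c; lia.
by move: ha; rewrite !IH -[count _ w]/(count isSome w); case: ltngtP => //; case: ltnP => //; lia.
Qed.

(* Open arcs are treated as closing at the same virtual vertex n, so that a
   strict nesting uses at most one of them, as its outermost arc. *)
Definition open_pred (n : nat) (ss : seq bool) : pred (nat * nat) :=
  fun a => (a.2 == n) && nth false (rev ss) a.1.

(** Two arcs ending at n are never strictly nested, and the word has at most one 0, at the first
    open vertex. *)
Lemma measures_one_row_word n ss : measures (open_pred n ss) (one_row_word ss).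
Proof.
move=> s r _; have zP : 0 < zeros s (one_row_word ss) <->
    exists2 i, i < s & nth false (rev ss) i.
  elim: ss => [|x ss IH]; first by split=> // -[i _]; rewrite nth_nil.
  rewrite /= size_one_row_word; split=> [|[i is_]].
    rewrite addn_gt0 => /orP[|/IH[i is_ hi]].
      rewrite lt0b => /andP[ssz hx]; exists (size ss) => //.
      by rewrite nth_rev_cons eqxx; case: x hx.
    exists i => //; rewrite nth_rev_cons; case: eqP => // ei.
    by rewrite ei nth_default ?size_rev in hi.
  rewrite nth_rev_cons addn_gt0; case: eqP => [ei hx|_ hi].
    rewrite -ei is_ hx /= lt0b (inj_eq Some_inj).
    have -> : zeros s (one_row_word ss) = (0 < count id ss).
      by rewrite zeros_all ?cnt_one_row_word // size_one_row_word -ei ltnW.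
    by case: (count id ss).
  by rewrite orbC; apply/orP; left; apply/IH; exists i.
have z1 : zeros s (one_row_word ss) <= 1.
  apply: leq_trans (zeros_mono _ (leq_maxl s (size ss))) _.
  by rewrite zeros_all ?size_one_row_word ?leq_maxr // cnt_one_row_word leq_b1.
case: r => [|[|r]]; first by split=> // _; exists [::].
  rewrite zP; split=> [[i is_ hi]|[[|a [|//]] // _]].
    by exists [:: (i, n)]; rewrite // nesting_cons /open_pred /= eqxx hi is_.
  by rewrite nesting_cons => /and4P[/andP[_ ha] as_ _ _]; exists a.1.
split=> [|[[|a [|c cs]] // _]]; first by rewrite ltnNge (leq_trans z1).
rewrite nesting_cons => /and4P[/andP[/eqP ea _] _ /andP[ac _]].
rewrite nesting_cons => /andP[/andP[/eqP ec _] _].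
by move: ac; rewrite /inside ea ec ltnn andbF.
Qed.

(** * Encoding of open partition diagrams *)

Section Encoding.

Variable n : nat.
Implicit Type D : diagram n.

Definition partner D (v : 'I_n) : option nat :=
  omap (fun a : 'I_n * 'I_n => val a.1) [pick a in enhanced_arcs D | a.2 == v].

Definition partners D : seq (option nat) := rev (map (partner D) (enum 'I_n)).

Definition openers D : seq bool := rev (map (mem (open_arcs D)) (enum 'I_n)).

Lemma size_partners D : size (partners D) = n.
Proof. by rewrite size_rev size_map size_enum_ord. Qed.

Lemma size_openers D : size (openers D) = n.
Proof. by rewrite size_rev size_map size_enum_ord. Qed.

Lemma nth_map_enum_ord (T : Type) (x0 : T) (f : 'I_n -> T) (v : 'I_n) :
  nth x0 (map f (enum 'I_n)) v = f v.
Proof. by rewrite (nth_map v) ?size_enum_ord // nth_ord_enum. Qed.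

Lemma count_openers D : count id (openers D) = #|open_arcs D|.
Proof. by rewrite count_rev count_map enumT cardE size_filter. Qed.

Lemma openersP D i :
  reflect (exists2 a, a \in open_arcs D & val a = i) (nth false (rev (openers D)) i).
Proof.
rewrite revK; apply: (iffP idP) => [|[a ao <-]]; last by rewrite nth_map_enum_ord.
case: (ltnP i n) => [li|ni]; last by rewrite nth_default // size_map size_enum_ord.
by rewrite -[i]/(val (Ordinal li)) nth_map_enum_ord => h; exists (Ordinal li).
Qed.

Lemma enhanced_arcsP D (i v : 'I_n) :
  reflect ((i, v) \in closed_arcs D \/ (i = v /\ isolated D v))
    ((i, v) \in enhanced_arcs D).
Proof.
rewrite inE; apply: (iffP orP) => -[h|h]; [by left| |by left|].
  by case/imsetP: h => x hx [-> ->]; right.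
by case: h => -> hv; right; apply/imsetP; exists v.
Qed.

Section Diagram.

Variable D : diagram n.
Hypothesis hD : is_open_partition_diagram D.

Lemma closed_lt a : a \in closed_arcs D -> a.1 < a.2.
Proof. by case/and4P: hD => /'forall_implyP h _ _ _; apply: h. Qed.

Lemma closed_inj_left a b :
  a \in closed_arcs D -> b \in closed_arcs D -> a.1 = b.1 -> a = b.
Proof.
case/and4P: hD => _ /'forall_implyP h _ _ ha hb e.
by have /'forall_implyP/(_ _ hb)/implyP := h _ ha; rewrite e eqxx => /(_ isT)/eqP.
Qed.

Lemma closed_inj_right a b :
  a \in closed_arcs D -> b \in closed_arcs D -> a.2 = b.2 -> a = b.
Proof.
case/and4P: hD => _ _ _ /'forall_implyP h ha hb e.
by have /'forall_implyP/(_ _ hb)/implyP := h _ ha; rewrite e eqxx => /(_ isT)/eqP.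
Qed.

Lemma closed_not_open a : a \in closed_arcs D -> a.1 \notin open_arcs D.
Proof. by case/and4P: hD => _ _ /'forall_implyP h _; apply: h. Qed.

Lemma isolated_closed a v :
  isolated D v -> a \in closed_arcs D -> (a.1 != v) && (a.2 != v).
Proof. by case/andP=> _ /'forall_implyP; apply. Qed.

Lemma enhanced_inj_left (i u v : 'I_n) :
  (i, u) \in enhanced_arcs D -> (i, v) \in enhanced_arcs D -> u = v.
Proof.
case/enhanced_arcsP=> [hu|[-> hu]] /enhanced_arcsP[hv|[ev hv]].
- by have [] := closed_inj_left hu hv erefl.
- by have := isolated_closed hv hu; rewrite ev eqxx.
- by have := isolated_closed hu hv; rewrite eqxx.
- by [].
Qed.

Lemma enhanced_inj_right (i j v : 'I_n) :
  (i, v) \in enhanced_arcs D -> (j, v) \in enhanced_arcs D -> i = j.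
Proof.
case/enhanced_arcsP=> [hi|[-> hi]] /enhanced_arcsP[hj|[ej hj]].
- by have [] := closed_inj_right hi hj erefl.
- by have := isolated_closed hj hi; rewrite eqxx andbF.
- by have := isolated_closed hi hj; rewrite eqxx andbF.
- by [].
Qed.

Lemma arcs_partners a :
  reflect (exists2 b, b \in enhanced_arcs D & (val b.1, val b.2) = a)
    (arcs (partners D) a).
Proof.
case: a => i v; rewrite /arcs revK /=; apply: (iffP eqP) => [|[[a w] ha [<- <-]] /=].
  case: (ltnP v n) => [lv|nv]; last by rewrite nth_default // size_map size_enum_ord.
  rewrite -[v]/(val (Ordinal lv)) nth_map_enum_ord /partner.
  by case: pickP => //= b /andP[hb /eqP eb] [<-]; exists b; rewrite // eb.
rewrite nth_map_enum_ord /partner; case: pickP => [[b w'] /andP[hb /eqP /= ew]|/(_ (a, w))].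
  by rewrite ew in hb; rewrite /= (enhanced_inj_right hb ha).
by rewrite /= ha eqxx.
Qed.

Lemma diagram_matching : matching (openers D) (partners D).
Proof.
split; first by rewrite size_openers size_partners.
- move=> i v /arcs_partners[[a b] hab [<- <-]] /=.
  case/enhanced_arcsP: hab => [h|[-> h]]; split=> //.
  + exact: ltnW (closed_lt h).
  + apply/openersP => -[c co /val_inj ec]; have := closed_not_open h.
    by rewrite -ec co.
  + apply/openersP => -[c co /val_inj ec]; case/andP: h.
    by rewrite -ec co.
- move=> i u v /arcs_partners[[a b] h [ea <-]] /arcs_partners[[a' b'] h' [/= ea' <-]] /=.
  have e : a' = a by apply: val_inj; rewrite /= ea' -ea.
  by rewrite e in h'; rewrite (enhanced_inj_left h h').
- move=> v; rewrite size_partners => lv pv; pose o := Ordinal lv.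
  have no_arc i : (i, o) \notin enhanced_arcs D.
    apply/negP => h; have : arcs (partners D) (val i, v) by apply/arcs_partners; exists (i, o).
    by rewrite /arcs /= pv.
  have [oo|no] := boolP (o \in open_arcs D); first by left; apply/openersP; exists o.
  (* An isolated vertex would end its own degenerate arc, so some closed arc touches o; as none ends
     there, it starts there. *)
  have : ~~ isolated D o by apply: contra (no_arc o) => h; apply/enhanced_arcsP; right.
  rewrite /isolated no /= negb_forall_in => /exists_inP[[a b] hab].
  rewrite negb_and !negbK => /orP[/eqP /= ea|/eqP /= eb].
    right; exists (val b); apply/arcs_partners; exists (a, b) => /=; last by rewrite ea.
    by apply/enhanced_arcsP; left.
  by have := no_arc a; rewrite -eb; case/negP; apply/enhanced_arcsP; left.
Qed.

(** The reversal is needed because [enhanced_nesting] lists the outermost arc first. *)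
Lemma nestingP (s : seq ('I_n * 'I_n)) :
  sorted inside (rev [seq (val a.1, val a.2) | a <- s]) =
  sorted ltn (left_ends s) && sorted gtn (right_ends s).
Proof.
by rewrite rev_sorted !sorted_map -sorted_relI; apply: eq_sorted.
Qed.

(** A nesting without virtual arc is an enhanced (k+1)-nesting. A virtual arc must be outermost, and
    removing it leaves an enhanced k-nesting to the right of an open left end. *)
Lemma has_nesting_diagram k :
  has_nesting (predU (open_pred n (openers D)) (arcs (partners D))) n k.+1 <->
  has_enhanced_nesting D k.+1 || has_future_enhanced_nesting D k.
Proof.
pose valp (a : 'I_n * 'I_n) := (val a.1, val a.2).
have lift c : all (arcs (partners D)) c ->
    exists2 s, all (mem (enhanced_arcs D)) s & c = rev (map valp s).
  elim: c => [|a c IH]; first by exists [::].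
  case/andP=> /arcs_partners[b hb <-] /IH[s hs ->]; exists (rcons s b).
    by rewrite all_rcons hs andbT.
  by rewrite map_rcons rev_rcons.
(* The middle inequality of an enhanced nesting holds for every enhanced arc. *)
have last_le s : all (mem (enhanced_arcs D)) s ->
    last 0 (left_ends s) <= last 0 (right_ends s).
  case/lastP: s => // s [a b]; rewrite all_rcons => /andP[hab _].
  rewrite /left_ends /right_ends !map_rcons !last_rcons /=.
  by case/enhanced_arcsP: hab => [/closed_lt/ltnW|[->]].
have down s : all (mem (enhanced_arcs D)) s -> all (arcs (partners D)) (rev (map valp s)).
  move=> /allP hs; rewrite all_rev all_map; apply/allP => a /hs ha /=.
  by apply/arcs_partners; exists a.
have inA s : all (mem (enhanced_arcs D)) s ->
    all (fun a => predU (open_pred n (openers D)) (arcs (partners D)) a && (a.1 < n))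
      (rev (map valp s)).
  move=> /down /allP hs; apply/allP => a /[dup] /hs ha; rewrite mem_rev => /mapP[b _ eb].
  by rewrite /= ha orbT eb /=.
split=> [[c]|/orP[/existsP[s /and4P[hs sl _ sr]]|]].
- case/lastP: c => // c a; rewrite size_rcons => -[sc] /andP[so al].
  have cin x : x \in c -> x.2 < a.2.
    move: so; rewrite -[rcons c a]revK rev_rcons rev_sorted /=.
    rewrite path_sortedE; last by move=> ? ? ? h1 h2; apply: inside_trans h2 h1.
    by case/andP=> /allP h _ xc; have := h x; rewrite mem_rev => /(_ xc) /andP[].
  move: al; rewrite all_rcons => /andP[/andP[ha la] /allP hc].
  have a2 : a.2 <= n.
    by case/orP: ha => [/andP[/eqP ->]//|/arcs_lt/ltnW]; rewrite size_partners.
  (* The inner arcs end strictly before a.2, hence before n, so none is virtual. *)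
  have {}hc : all (arcs (partners D)) c.
    apply/allP => x xc; have /andP[/orP[/andP[/eqP ex _]|//] _] := hc _ xc.
    by have := cin _ xc; rewrite ex ltnNge a2.
  case/orP: ha => [/andP[ea /openersP[o oo eo]]|ha]; last first.
    have [s hs ec] : exists2 s, all (mem (enhanced_arcs D)) s & rcons c a = rev (map valp s).
      by apply: lift; rewrite all_rcons ha.
    have ss : size s == k.+1 by rewrite -sc -(size_rcons c a) ec size_rev size_map.
    apply/orP; left; apply/existsP; exists (Tuple ss).
    move: so; rewrite ec nestingP => /andP[sl sr].
    by rewrite /enhanced_nesting hs sl sr last_le.
  have [s hs ec] := lift _ hc.
  have ss : size s == k by rewrite -sc ec size_rev size_map.
  apply/orP; right; apply/existsP; exists o; rewrite oo /=.
  apply/existsP; exists (Tuple ss); rewrite /enhanced_nesting hs last_le //=.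
  have := so; rewrite ec -rev_cons rev_sorted /= => pso.
  have : sorted inside (rev (map valp s)) by rewrite rev_sorted (path_sorted pso).
  rewrite nestingP => /andP[-> ->] /=.
  have := sub_path (e' := relpre fst ltn) _ pso; rewrite -path_map => /(_ _).
  by rewrite -map_comp eo; apply => x y /andP[].
- exists (rev (map valp s)); first by rewrite size_rev size_map size_tuple.
  by rewrite /nesting nestingP sl sr inA.
- case/exists_inP=> o oo /existsP[s /andP[/and4P[hs sl _ sr] ps]].
  exists (rcons (rev (map valp s)) (val o, n)).
    by rewrite size_rcons size_rev size_map size_tuple.
  apply/andP; split; last first.
    rewrite all_rcons inA // andbT ltn_ord andbT /= /open_pred /= eqxx.
    by apply/orP; left; apply/openersP; exists o.
  have so : sorted inside (rev (map valp s)) by rewrite nestingP sl sr.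
  rewrite -rev_cons rev_sorted /= path_sortedE; last first.
    by move=> ? ? ? h1 h2; apply: inside_trans h2 h1.
  rewrite -rev_sorted so andbT; apply/allP => x /mapP[b bs ->].
  rewrite /inside /= ltn_ord andbT.
  by have /allP := order_path_min ltn_trans ps; apply; apply: map_f.
Qed.

End Diagram.

End Encoding.

(** Closed arcs are recovered from [partners] as the arcs with distinct ends. *)
Lemma diagram_inj n (D D' : diagram n) :
  is_open_partition_diagram D -> is_open_partition_diagram D' ->
  openers D = openers D' -> partners D = partners D' -> D = D'.
Proof.
move=> hD hD' eo ep.
have closedE (E : diagram n) (hE : is_open_partition_diagram E) a :
    (a \in closed_arcs E) = arcs (partners E) (val a.1, val a.2) && (a.1 < a.2).
  case: a => i v /=; apply/idP/andP => [h|[/(arcs_partners hE)[[j u] + [/val_inj ei /val_inj ev]]]].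
    split; last exact: (closed_lt hE h).
    by apply/(arcs_partners hE); exists (i, v) => //; apply/enhanced_arcsP; left.
  by rewrite ei ev => /enhanced_arcsP[//|[-> _]]; rewrite ltnn.
rewrite [D]surjective_pairing [D']surjective_pairing; congr pair.
  by apply/setP => a; rewrite -![_.1]/(closed_arcs _) !closedE // ep.
apply/setP => a; rewrite -![_.2]/(open_arcs _).
have h (E : diagram n) : (a \in open_arcs E) = nth false (rev (openers E)) a.
  by apply/idP/openersP => [ao|[b bo /val_inj <-] //]; exists a.
by rewrite !h eo.
Qed.

Lemma diagram_of_matching n ss ps : matching ss ps -> size ps = n ->
  exists D : diagram n,
    [/\ is_open_partition_diagram D, openers D = ss & partners D = ps].
Proof.
case=> sz arc inj cov sn.
pose D : diagram n :=
  ([set a : 'I_n * 'I_n | arcs ps (val a.1, val a.2) && (a.1 < a.2)],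
   [set a : 'I_n | nth false (rev ss) a]).
have cD a : (a \in closed_arcs D) = arcs ps (val a.1, val a.2) && (a.1 < a.2) by rewrite inE.
have oD a : (a \in open_arcs D) = nth false (rev ss) a by rewrite inE.
have arc_right i j v : arcs ps (i, v) -> arcs ps (j, v) -> i = j.
  by rewrite /arcs /= => /eqP -> /eqP[].
have hD : is_open_partition_diagram D.
  apply/and4P; split.
  - by apply/'forall_implyP => a; rewrite cD => /andP[].
  - apply/'forall_implyP => -[a b]; rewrite cD => /andP[h _].
    apply/'forall_implyP => -[a' b']; rewrite cD => /andP[h' _]; apply/implyP => /eqP /= e.
    by subst; have /= /val_inj -> := inj _ _ _ h h'.
  - by apply/'forall_implyP => a; rewrite cD oD => /andP[/arc[_ ->]].
  - apply/'forall_implyP => -[a b]; rewrite cD => /andP[h _].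
    apply/'forall_implyP => -[a' b']; rewrite cD => /andP[h' _]; apply/implyP => /eqP /= e.
    by subst; have /= /val_inj -> := arc_right _ _ _ h h'.
(* Covering gives an unmarked vertex some arc, which is degenerate if no closed arc touches the
   vertex. Conversely, uniqueness of arcs at both ends lets a degenerate arc exclude all others. *)
have isoE v : isolated D v = arcs ps (val v, val v).
  apply/andP/idP => [[no /'forall_implyP na]|h].
    have /= := cov v; rewrite sn ltn_ord => /(_ isT).
    case E: (nth None (rev ps) v) => [i|] => [_|/(_ erefl)[hv|[u hu]]].
    - have h : arcs ps (i, val v) by rewrite /arcs E.
      have [iv _] := arc _ _ h; move: iv; rewrite leq_eqVlt => /orP[/eqP ei|iv]; first by rewrite -{1}ei.
      have li := ltn_trans iv (ltn_ord v).
      by have := na (Ordinal li, v); rewrite cD /= h iv eqxx andbF => /(_ isT).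
    - by rewrite oD hv in no.
    - have [vu _] := arc _ _ hu; move: vu; rewrite leq_eqVlt => /orP[/eqP eu|vu]; first by rewrite {2}eu.
      have lu : u < n by rewrite -sn; apply: arcs_lt hu.
      by have := na (v, Ordinal lu); rewrite cD /= hu vu eqxx => /(_ isT).
  split; first by rewrite oD; have [_ ->] := arc _ _ h.
  apply/'forall_implyP => -[a b]; rewrite cD /= => /andP[hab ab]; apply/andP; split.
    by apply: contraTneq ab => ea; subst; rewrite (inj _ _ _ hab h) ltnn.
  by apply: contraTneq ab => eb; subst; rewrite (arc_right _ _ _ hab h) ltnn.
exists D; split=> //.
  apply: (can_inj revK); apply: (@eq_from_nth _ false); first by rewrite size_rev size_openers size_rev sz.
  rewrite size_rev size_openers => i li; rewrite revK -[i]/(val (Ordinal li)) nth_map_enum_ord.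
  by rewrite inE.
apply: (can_inj revK); apply: (@eq_from_nth _ None); first by rewrite size_rev size_partners size_rev.
rewrite size_rev size_partners => v lv.
have h i : arcs (partners D) (i, v) = arcs ps (i, v).
  apply/(arcs_partners hD)/idP => [[[a b] /enhanced_arcsP hab [<- <-]]|hi].
    by case: hab => [|[-> +]]; rewrite ?isoE // cD => /andP[].
  have [iv _] := arc _ _ hi; pose o := Ordinal lv; pose oi := Ordinal (leq_ltn_trans iv lv).
  exists (oi, o) => //; apply/enhanced_arcsP; rewrite cD isoE /= hi.
  have := iv; rewrite leq_eqVlt => /orP[/eqP ei|->]; last by left.
  by right; split; [apply: val_inj|rewrite -{1}ei].
case E: (nth None (rev (partners D)) v) => [i|]; first by have := h i; rewrite /arcs E eqxx /= => /esym/eqP.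
by case E': (nth None (rev ps) v) => [i|] //; have := h i; rewrite /arcs E E' eqxx.
Qed.

(** Existence is known only in [Prop], so both maps are chosen by indefinite description; uniqueness
    makes the choices mutually inverse. *)
Lemma bijection_of_relation (A B : Type) (R : A -> B -> Prop) :
  (forall a, exists b, R a b) -> (forall b, exists a, R a b) ->
  (forall a b b', R a b -> R a b' -> b = b') ->
  (forall a a' b, R a b -> R a' b -> a = a') ->
  exists f : A -> B, bijective f.
Proof.
move=> tA tB fA fB.
pose f a := proj1_sig (constructive_indefinite_description _ (tA a)).
pose g b := proj1_sig (constructive_indefinite_description _ (tB b)).
have fP a : R a (f a) by rewrite /f; case: constructive_indefinite_description.
have gP b : R (g b) b by rewrite /g; case: constructive_indefinite_description.
exists f; exists g => [a|b]; first exact: fB (gP _) (fP _).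
exact: fA (fP _) (gP _).
Qed.

(** * The bijection between tableaux and diagrams *)

Lemma growth_diagram_height n (D : diagram n) k l :
  is_open_partition_diagram D ->
  growth (partners D) (one_row_word (openers D)) l ->
  all (fun la => size la <= k) l =
  ~~ has_enhanced_nesting D k.+1 && ~~ has_future_enhanced_nesting D k.
Proof.
move=> hD g; rewrite -negb_or; apply/idP/negP => [h|h].
  move/(has_nesting_diagram hD).
  have := (growth_height k g (@measures_one_row_word n _) _).1; rewrite size_partners.
  by apply=> // a /andP[/eqP ->].
apply/(growth_height k g (@measures_one_row_word n (openers D))).
  by move=> a /andP[/eqP ->]; rewrite size_partners.
by rewrite size_partners => /(has_nesting_diagram hD).
Qed.

Lemma hesitating_rev n m k (t : (2 * n).+1.-tuple (seq nat)) :
  is_hesitating_tableau k m t =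
  [&& all ferrers t, all (fun la => size la <= k) t,
      head [::] (rev t) == one_row m & hesitating (rev t)].
Proof.
have sl : size (rev t) = (2 * n).+1 by rewrite size_rev size_tuple.
have -> : head [::] (rev t) = nth [::] t (2 * n).
  by rewrite -nth0 nth_rev size_tuple // subn1.
rewrite /is_hesitating_tableau /=; congr [&& _, _ & _].
rewrite andbCA; congr andb; apply/andP/idP => [[/eqP t0 /forallP tm]|].
  apply/(hesitatingP sl); rewrite revK; split=> // i li.
  exact: tm (Ordinal li).
by case/(hesitatingP sl); rewrite revK => -> tm; split=> //; apply/forallP => i; apply: tm.
Qed.

Lemma tableau_diagram_bijection n m k :
  exists f : hesitating_tableau k n m -> open_diagram k n m, bijective f.
Proof.
pose R (t : hesitating_tableau k n m) (D : open_diagram k n m) :=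
  growth (partners (sval D)) (one_row_word (openers (sval D))) (rev (sval t)).
apply: (@bijection_of_relation _ _ R).
- case=> t ht; have := ht; rewrite hesitating_rev => /and4P[ft st /eqP tn tm].
  have sl : size (rev t) = (2 * n).+1 by rewrite size_rev size_tuple.
  have [|ps [w g]] := growth_total sl tm; first by rewrite all_rev.
  have [sw sl'] := growth_size g; have spn : size ps = n by rewrite sl in sl'; lia.
  have lw := growth_lattice g; have [l' el] := growth_head g.
  have shw : row_shape w = one_row m by rewrite -tn el.
  have [D [hD eo ep]] := diagram_of_matching (growth_matching g) spn.
  (* The one-row final shape makes w the word from which the scan of D starts. *)
  have ew : one_row_word (openers D) = w.
    by rewrite eo one_row_word_occupied // shw /one_row; case: eqP.
  have gD : growth (partners D) (one_row_word (openers D)) (rev t) by rewrite ep ew.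
  have hO : in_Omega D k m.
    apply/and4P; have := growth_diagram_height k hD gD.
    rewrite all_rev st => /esym/andP[-> ->]; split=> //.
    (* Open arcs are the letters of the final word, one per box of (m). *)
    rewrite -count_openers eo count_map -[count _ w]/(count isSome w) -sumn_row_shape shw.
    by rewrite /one_row; case: (eqVneq m 0) => [->|_] //=; rewrite addn0.
  by exists (exist _ D hO).
- case=> D hO; case/and4P: (hO) => hD /eqP ho h1 h2.
  have [|l g] := @matching_growth (partners D) _ (lattice_one_row_word (openers D)).
    by rewrite occupied_one_row_word; apply: diagram_matching.
  have [_ sl] := growth_size g; rewrite size_partners in sl.
  have st : size (rev l) == (2 * n).+1 by rewrite size_rev sl.
  have ht : is_hesitating_tableau k m (Tuple st).
    have [hl fl] := growth_hesitating g; have [l' el] := growth_head g.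
    rewrite hesitating_rev /= revK !all_rev fl hl (growth_diagram_height k hD g) h1 h2.
    by rewrite el /= row_shape_one_row_word count_openers ho eqxx.
  by exists (exist _ (Tuple st) ht); rewrite /R /= revK.
- case=> t ht [D hO] [D' hO'] g g'; apply: val_inj => /=.
  case/and4P: (hO) (hO') => hD _ _ _ /and4P[hD' _ _ _].
  have [ep ew] := growth_inj g g'; apply: diagram_inj => //.
  by rewrite -[LHS]occupied_one_row_word /= ew occupied_one_row_word.
- case=> t ht [t' ht'] D g g'; apply: val_inj; apply: val_inj => /=.
  by apply: (can_inj revK); apply: growth_fun g g'.
Qed.

(** * Tableaux and walks *)

Section Walks.

Local Open Scope ring_scope.

Import GRing.Theory Num.Theory.

Variable k : nat.

Definition lattice_point (la : seq nat) : 'rV[int]_k :=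
  \row_(i < k) (nth 0 la i + (k - i))%N%:Z.

Lemma lattice_point_nil : lattice_point [::] = delta k.
Proof. by apply/rowP => i; rewrite !mxE nth_nil. Qed.

Lemma lattice_point_inj la mu :
  ferrers la -> ferrers mu -> (size la <= k)%N -> (size mu <= k)%N ->
  lattice_point la = lattice_point mu -> la = mu.
Proof.
move=> fla fmu sla smu e; apply: ferrers_nth_inj => // i.
have [ik|ki] := ltnP i k; last by rewrite !nth_default // (leq_trans _ ki).
by have /rowP/(_ (Ordinal ik)) := e; rewrite !mxE /=; lia.
Qed.

Lemma in_chamber_lattice_point la : ferrers la -> in_chamber (lattice_point la).
Proof.
move=> fla; apply/andP; split; last first.
  by apply/forallP => i; rewrite mxE; have := ltn_ord i; lia.
apply/'forall_forallP => i j; apply/implyP => ij; rewrite !mxE.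
by have := ferrers_nth fla (ltnW ij); have := ltn_ord j; lia.
Qed.

Lemma lattice_point_in_chamber x : in_chamber x ->
  exists la, [/\ ferrers la, (size la <= k)%N & lattice_point la = x].
Proof.
case/andP=> /'forall_forallP dec /forallP pos.
(* Going up from the last coordinate, x_i is at least k - i, so the truncated subtraction in [c] is
   exact. *)
have lb d (i : 'I_k) : (i + d).+1 = k -> d%:Z < x 0 i.
  elim: d i => [|d IH] i id_; first exact: pos.
  have i1 : (i.+1 < k)%N by lia.
  have := IH (Ordinal i1); have := dec i (Ordinal i1); rewrite /= ltnSn /=; lia.
pose c (i : 'I_k) := (absz (x 0%R i) - (k - i))%N.
have cE i : x 0 i = (c i + (k - i))%N%:Z.
  by have := lb (k - i).-1 i; rewrite /c; have := ltn_ord i; lia.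
pose s := [seq c i | i <- enum 'I_k].
have ss : size s = k by rewrite size_map size_enum_ord.
have sorted_s : sorted geq s.
  apply/(sortedP 0%N) => i; rewrite ss => i1.
  have i0 := ltnW i1; rewrite -[i.+1]/(val (Ordinal i1)) -[X in nth _ _ X]/(val (Ordinal i0)).
  rewrite !nth_map_enum_ord.
  by have := dec (Ordinal i0) (Ordinal i1); rewrite /= ltnSn !cE /=; lia.
(* The zeros of a decreasing sequence form its tail, so the default 0 replaces them after
   deletion. *)
have nth_filter : nth 0%N (filter (predC1 0%N) s) =1 nth 0%N s.
  elim: s sorted_s {ss} => //= a s IH pas; have {}IH := IH (path_sorted pas).
  case: eqP => [a0|_] /= i; last by case: i.
  have s0 : all (pred1 0%N) s.
    move: pas; rewrite (path_sortedE (rev_trans leq_trans)) => /andP[+ _].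
    by apply: sub_all => y /=; rewrite a0 leqn0.
  have -> : filter (predC1 0%N) s = [::].
    by apply/eqP; rewrite -[_ == _]negbK -has_filter has_predC s0.
  rewrite nth_nil a0; case: i => //= i; have [li|?] := ltnP i (size s); last by rewrite nth_default.
  by have /eqP -> := allP s0 _ (mem_nth 0%N li).
exists (filter (predC1 0%N) s); split.
- apply/andP; split; first exact: sorted_filter (rev_trans leq_trans) _ _ sorted_s.
  by rewrite mem_filter.
- by rewrite size_filter -ss count_size.
- by apply/rowP => i; rewrite mxE nth_filter nth_map_enum_ord cE.
Qed.

Lemma add_box_unit_vec la mu :
  ferrers la -> ferrers mu -> (size la <= k)%N -> (size mu <= k)%N ->
  add_box la mu = [exists i, lattice_point mu - lattice_point la == unit_vec i].
Proof.
move=> fla fmu sla smu; apply/add_boxP/existsP => [[r lr emu]|[[r rk] /eqP e]].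
  have rk : (r < k)%N.
    by apply: leq_trans smu; rewrite -ferrers_nth_gt0 // emu nth_incr_nth eqxx.
  exists (Ordinal rk); apply/eqP/rowP => j; rewrite !mxE emu nth_incr_nth /=.
  by rewrite -(inj_eq val_inj) /= eq_sym; case: eqP; lia.
have nE j : nth 0%N mu j = ((r == j) + nth 0%N la j)%N.
  have [jk|kj] := ltnP j k.
    have /rowP/(_ (Ordinal jk)) := e; rewrite !mxE /= -(inj_eq val_inj) /= eq_sym.
    by case: eqP; lia.
  rewrite !nth_default ?(leq_trans _ kj) // ltn_eqF //.
  exact: leq_trans rk kj.
(* Otherwise the box would lie below an empty row of [mu]. *)
have rl : (r <= size la)%N.
  rewrite leqNgt; apply/negP => lt.
  have := ferrers_nth fmu (ltnW lt); rewrite !nE eqxx (gtn_eqF lt).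
  by rewrite [nth 0%N la (size la)]nth_default.
exists r => //; apply: (@eq_from_nth _ 0%N) => [|j _]; last by rewrite nth_incr_nth nE.
have h j : (j < size mu)%N = (0 < nth 0%N mu j)%N by rewrite ferrers_nth_gt0.
have h' j : (j < size la)%N = (0 < nth 0%N la j)%N by rewrite ferrers_nth_gt0.
rewrite size_incr_nth; case: ltnP => lr.
  have := h (size mu); have := h (size la); have := h' (size mu); have := h' (size la).
  by rewrite !nE; do 2 case: eqP; lia.
have := h r; have := h r.+1; have := h' r.+1.
by rewrite !nE eqxx (ltn_eqF (ltnSn r)); lia.
Qed.

Lemma hesitating_moves_steps la mu nu :
  ferrers la -> ferrers mu -> ferrers nu ->
  (size la <= k)%N -> (size mu <= k)%N -> (size nu <= k)%N ->
  hesitating_moves la mu nu =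
  hesitating_steps (lattice_point mu - lattice_point la)
    (lattice_point nu - lattice_point mu).
Proof.
move=> fla fmu fnu sla smu snu.
have eqE a b : ferrers a -> ferrers b -> (size a <= k)%N -> (size b <= k)%N ->
    (lattice_point b - lattice_point a == 0) = (b == a).
  move=> fa fb sa sb; rewrite subr_eq0; apply/eqP/eqP => [|-> //].
  exact: lattice_point_inj.
have remE a b : ferrers a -> ferrers b -> (size a <= k)%N -> (size b <= k)%N ->
    remove_box a b = [exists i, lattice_point b - lattice_point a == - unit_vec i].
  move=> fa fb sa sb; rewrite /remove_box add_box_unit_vec //.
  by apply: eq_existsb => i; rewrite -eqr_oppLR opprB.
by rewrite /hesitating_moves /hesitating_steps !eqE // !remE // !add_box_unit_vec.
Qed.

Lemma is_endpoint_lattice_point m la : ferrers la -> (size la <= k)%N ->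
  is_endpoint m (lattice_point la) = (la == one_row m).
Proof.
move=> fla sla.
have fm : ferrers (one_row m) by rewrite /one_row; case: eqP => // ?; rewrite /ferrers /= inE; lia.
(* The guard of [is_endpoint] says that (m) fits in k rows; it fails only for k = 0 and m > 0. *)
have sm : (size (one_row m) <= k)%N = (0 < k)%N || (m == 0%N).
  by rewrite /one_row; case: eqP => //=; rewrite ?orbT ?orbF.
have -> : is_endpoint m (lattice_point la) =
    (size (one_row m) <= k)%N && (lattice_point la == lattice_point (one_row m)).
  rewrite /is_endpoint sm; congr (_ && (_ == _)); apply/rowP => i; rewrite !mxE.
  rewrite /one_row; case: (eqVneq m 0%N) => [->|_]; case: i => [[|[|j]] lj] //=; lia.
apply/andP/eqP => [[sm' /eqP]|el]; first exact: lattice_point_inj.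
by rewrite -el sla eqxx.
Qed.

Lemma position0 n (w : (2 * n).-tuple 'rV[int]_k) : position w 0 = delta k.
Proof. by rewrite /position take0 big_nil addr0. Qed.

Lemma positionS n (w : (2 * n).-tuple 'rV[int]_k) t : (t < 2 * n)%N ->
  position w t.+1 = position w t + nth 0 w t.
Proof.
move=> lt; rewrite /position (take_nth 0) ?size_tuple //.
by rewrite -cats1 big_cat big_seq1 addrA.
Qed.

Definition traces n (t : (2 * n).+1.-tuple (seq nat)) (w : (2 * n).-tuple 'rV[int]_k) :=
  forall s, (s <= 2 * n)%N -> position w s = lattice_point (nth [::] t s).

Lemma traces_valid n m t (w : (2 * n).-tuple 'rV[int]_k) : traces t w ->
  all ferrers t -> all (fun la => (size la <= k)%N) t ->
  nth [::] t 0 = [::] /\ is_hesitating_walk m w <-> is_hesitating_tableau k m t.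
Proof.
move=> tw ft st.
have ft_ s : (s <= 2 * n)%N -> ferrers (nth [::] t s).
  by move=> ls; apply: (allP ft); rewrite mem_nth // size_tuple.
have st_ s : (s <= 2 * n)%N -> (size (nth [::] t s) <= k)%N.
  by move=> ls; apply: (allP st (nth [::] t s)); rewrite mem_nth // size_tuple.
have nthw s : (s < 2 * n)%N ->
    nth 0 w s = lattice_point (nth [::] t s.+1) - lattice_point (nth [::] t s).
  by move=> ls; rewrite -!tw ?positionS ?(ltnW ls) // addrC addKr.
have movesE (i : 'I_n) : hesitating_moves (nth [::] t (2 * i)) (nth [::] t (2 * i).+1)
      (nth [::] t (2 * i).+2) = hesitating_steps (nth 0 w (2 * i)) (nth 0 w (2 * i).+1).
  have li := ltn_ord i; rewrite !nthw; try lia.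
  by apply: hesitating_moves_steps; (apply: ft_ || apply: st_); lia.
have endE : is_endpoint m (position w (2 * n)) = (nth [::] t (2 * n) == one_row m).
  by rewrite tw // is_endpoint_lattice_point ?ft_ ?st_.
split=> [[t0 /and3P[/forallP hs _ he]]|].
  apply/and5P; split=> //; [exact/eqP|by rewrite -endE|].
  by apply/forallP => i; rewrite movesE.
case/and5P=> _ _ /eqP t0 tn /forallP tm; split=> //; apply/and3P; split; last by rewrite endE.
  by apply/forallP => i; rewrite -movesE.
apply/forallP => s; have ls : (s <= 2 * n)%N by rewrite -ltnS.
by rewrite tw // in_chamber_lattice_point // ft_.
Qed.

Lemma tableau_walk_bijection n m :
  exists f : hesitating_tableau k n m -> hesitating_walk k n m, bijective f.
Proof.
apply: (@bijection_of_relation _ _ (fun t w => traces (sval t) (sval w))).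
- case=> t ht; case/and5P: (ht) => ft st /eqP t0 _ _.
  pose w : (2 * n).-tuple 'rV[int]_k := [tuple lattice_point (nth [::] t i.+1) -
    lattice_point (nth [::] t i) | i < 2 * n].
  have tw : traces t w.
    elim=> [_|s IH ls]; first by rewrite position0 t0 lattice_point_nil.
    rewrite positionS // IH 1?ltnW // -[s in nth 0 _ s]/(val (Ordinal ls)) -tnth_nth tnth_mktuple /=.
    by rewrite addrC subrK.
  have [_ hw] := (traces_valid m tw ft st).2 ht.
  by exists (exist _ w hw).
- case=> w hw; case/and3P: (hw) => _ /forallP hc _.
  (* The tableau is chosen point by point: subtracting delta from a chamber point gives a diagram
     with at most k rows. *)
  pose la (s : 'I_(2 * n).+1) :=
    proj1_sig (constructive_indefinite_description _ (lattice_point_in_chamber (hc s))).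
  have laP s : [/\ ferrers (la s), (size (la s) <= k)%N & lattice_point (la s) = position w s].
    by rewrite /la; case: constructive_indefinite_description.
  pose t := [tuple la s | s < (2 * n).+1].
  have tw : traces t w.
    move=> s ls; rewrite -[s in nth _ _ s]/(val (Ordinal (ls : (s < (2 * n).+1)%N))).
    by rewrite -tnth_nth tnth_mktuple; have [_ _ ->] := laP (Ordinal (ls : (s < (2 * n).+1)%N)).
  have ft : all ferrers t by apply/allP => _ /mapP[s _ ->]; have [] := laP s.
  have st : all (fun la => (size la <= k)%N) t by apply/allP => _ /mapP[s _ ->]; have [] := laP s.
  have t0 : nth [::] t 0 = [::].
    apply: lattice_point_inj; rewrite ?lattice_point_nil -?tw ?position0 //.
      by apply: (allP ft); rewrite mem_nth // size_tuple.
    by apply: (allP st (nth [::] t 0)); rewrite mem_nth // size_tuple.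
  have ht := (traces_valid m tw ft st).1 (conj t0 hw).
  by exists (exist _ t ht).
- case=> t ht [w hw] [w' hw'] tw tw'; apply: val_inj; apply: val_inj => /=.
  apply: (@eq_from_nth _ 0); rewrite !size_tuple // => s ls.
  apply: (addrI (position w s)); rewrite -positionS // tw //=.
  by rewrite (tw s) 1?ltnW //= -(tw' s) 1?ltnW //= -positionS //= tw'.
- case=> t ht [t' ht'] [w hw] tw tw'; apply: val_inj; apply: val_inj => /=.
  apply: (@eq_from_nth _ [::]); rewrite !size_tuple // => s; rewrite ltnS => ls.
  case/and5P: (ht) (ht') => ft st _ _ _ /and5P[ft' st' _ _ _].
  have mt (u : (2 * n).+1.-tuple (seq nat)) : nth [::] u s \in u by rewrite mem_nth // size_tuple.
  apply: lattice_point_inj.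
  + exact: (allP ft).
  + exact: (allP ft').
  + exact: (allP st (nth [::] t s)).
  + exact: (allP st' (nth [::] t' s)).
  + by rewrite -tw // -tw'.
Qed.

End Walks.

Theorem theorem1 (n m k : nat) :
  (exists f : hesitating_tableau k n m -> hesitating_walk k n m, bijective f) /\
  (exists g : hesitating_walk k n m -> open_diagram k n m, bijective g).
Proof.
have [f bf] := tableau_walk_bijection k n m.
have [h bh] := tableau_diagram_bijection n m k.
split; first by exists f.
have [f' ff' f'f] := bf; exists (h \o f'); apply: bij_comp => //.
by exists f.
Qed.
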